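(* Let $m\ge 3$, $n\ge 1$, and let $A\in\mathbb{R}^{n\times n}$ be symmetric with zero diagonal. For $2\le k\le m$ and $1\le t\le b_{m,k}$, let ${\cal G}_{m,k,t}$ be a chosen representative of the $t$-th isomorphism class of self-loop-free induced FAMs of size $k$, let $\sigma_{m,k,t}=\{S_1,\dots,S_k\}$ be its inducing partition, $d_{m,k,t}$ the cardinality of the class, and $a_{m,k,t}=d_{m,k,t}\,(-1)^{m-k}\prod_{i=1}^k(|S_i|-1)!$. Let ${\cal G}_{m,k,t}^{\mathrm{final}}$ be the output of the pruning algorithm applied to ${\cal G}_{m,k,t}$ (with any choice of initial edge orientations and any choices of pendant nodes). Then $$C_m=\sum_{k=2}^m\sum_{t=1}^{b_{m,k}}a_{m,k,t}\cdot\mathrm{FS}({\cal G}_{m,k,t}^{\mathrm{final}}).$$ Furthermore, for each ${\cal G}_{m,k,t}^{\mathrm{final}}$ there are only two possible cases: Case 1: it has exactly one node. If $v\in\mathbb{R}^n$ denotes the label of this node, then $\mathrm{FS}({\cal G}_{m,k,t}^{\mathrm{final}})={\bf 1}_n'v$, and this is an SEA term. Case 2: it has more than one node and no pendant node. Then it has at least $4$ nodes, each with at least $3$ immediate neighbors, and $\mathrm{FS}({\cal G}_{m,k,t}^{\mathrm{final}})$ is an $\ell$-layer FS term with $4\le \ell\le\lfloor m/2\rfloor$, where $\ell$ is the number of nodes of ${\cal G}_{m,k,t}^{\mathrm{final}}$.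
   Context: Cycle count statistic: $C_m=\sum_{1\le i_1,\ldots,i_m\le n,\ \text{all distinct}}A_{i_1i_2}A_{i_2i_3}\cdots A_{i_mi_1}$. FAM: a fully annotated multigraph (FAM) is a finite multigraph with nodes $1,\ldots,k$ (parallel edges allowed), each node $a$ labeled by a vector $v^{(a)}\in\mathbb{R}^n$, and each edge $(a,b,s)$ (the $s$-th edge from $a$ to $b$) labeled by a matrix $M^{(a,b,s)}\in\mathbb{R}^{n\times n}$. It may be directed or undirected; in an undirected FAM all edge labels are symmetric. With $E({\cal G})$ the set of edges, its Full Sum is $$\mathrm{FS}({\cal G})=\sum_{1\le j_1,\ldots,j_k\le n}\ \prod_{a=1}^k v^{(a)}_{j_a}\prod_{(a,b,s)\in E({\cal G})}M^{(a,b,s)}_{j_aj_b}.$$ Induced FAMs: let $S=\{i_1,\ldots,i_m\}$ be $m$ distinct symbols arranged in the $m$-cycle graph with edges $i_1i_2,\ldots,i_{m-1}i_m,i_mi_1$. For a partition $\sigma=\{S_1,\ldots,S_k\}$ of $S$ into non-empty blocks, the induced FAM ${\cal G}_\sigma$ is the undirected multigraph on $k$ nodes obtained by merging each block into one node and keeping all $m$ edges; every node is labeled by the all-ones vector ${\bf 1}_n$ and every edge by $A$; its size is $k$. Discard those with self-loops. Two induced FAMs are isomorphic if one is obtained from the other by a permutation of nodes (preserving edge multiplicities). For $2\le k\le m$, $b_{m,k}$ is the number of isomorphism classes of self-loop-free induced FAMs of size $k$, and the cardinality $d_{m,k,t}$ of the $t$-th class is the number of partitions $\sigma$ with ${\cal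 G}_\sigma$ in that class. Pendants: in a FAM without self-loops, node $b\ne a$ is an immediate neighbor of $a$ if there is at least one edge between them (ignoring directions). A node is a Type-I pendant if it has exactly one immediate neighbor, and a Type-II pendant if it has exactly two; these neighbors are its hinges. Orientation alignment from $a$ to $b$: every edge directed from $b$ to $a$ is reversed and its label transposed; edges from $a$ to $b$ are unchanged. Type-I pruning of a pendant $p$ with hinge $h$: align all edges between them from $h$ to $p$; let $M^{(1)},\ldots,M^{(s)}$ be their labels after alignment, $v$ the label of $p$, $u$ the label of $h$. Remove $p$ and its edges and replace the label of $h$ by $u\circ[(M^{(1)}\circ\cdots\circ M^{(s)})v]$. Here $\circ$ is the entry-wise product. Type-II pruning of a pendant $p$ with hinges $x,z$: align all its edges so that they point from $p$ to the hinges; let $Q^{(1)},\ldots,Q^{(s)}$ be the labels of the edges from $p$ to $x$, $R^{(1)},\ldots,R^{(r)}$ those from $p$ to $z$ (after alignment), and $y$ the label of $p$. Remove $p$ and its edges and add a new directed edge (in addition to any existing ones) from $x$ to $z$ with label $(Q^{(1)}\circ\cdots\circ Q^{(s)})^\top\,\mathrm{diag}(y)\,(R^{(1)}\circ\cdots\circ R^{(r)})$. In both prunings everything else is unchanged. Pruning algorithm: start from ${\cal G}_{m,k,t}$ with an arbitrary orientation assigned to each edge; as long as there is more than one node and some pendant node exists, choose an arbitrary pendant node and prune it; stop when only one node remains or no pendant node exists. The resulting FAM is ${\cal G}_{m,k,t}^{\mathrm{final}}$. SEA term: a (scalar) term that is an expression in $A$ and ${\bf 1}_n$ constructed using only (i)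 multiplication (of two matrices, a matrix and a vector, or ${\bf 1}_n'$ and a vector), (ii) entry-wise product (of two matrices or of two vectors), and (iii) the diagonal operation (taking a matrix to the diagonal matrix with the same diagonal, or a vector $y$ to the diagonal matrix $\mathrm{diag}(y)$). $\ell$-layer FS term: a term of the form $\sum_{1\le i_1,\ldots,i_\ell\le n}X^{(1)}_{j_1k_1}\cdots X^{(N)}_{j_Nk_N}$, $N\ge1$, where each index $j_s,k_s$ is one of the summation indices $i_1,\ldots,i_\ell$, and each $X^{(s)}$ is an $n\times n$ matrix built from $A$ and ${\bf 1}_n$ by operations (i)-(iii); either $j_s$ and $k_s$ are different summation indices, or they are the same summation index and $X^{(s)}$ is a diagonal matrix (encoding a node label). *)

(* Defs.v *)
(* MathComp; the main statement is over an arbitrary [realType], the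
   definitions only need a commutative ring. *)
From mathcomp Require Import all_boot all_order all_fingroup all_algebra.
From mathcomp Require Import reals.

Set Implicit Arguments.
Unset Strict Implicit.
Unset Printing Implicit Defensive.

Import GRing.Theory.
Local Open Scope ring_scope.

Definition sym_hollow (R : comNzRingType) n (A : 'M[R]_n) : Prop :=
  A^T = A /\ forall i, A i i = 0.

(* The index [s.+1 mod m] following [s] on the m-cycle is [ordS s]. *)
Definition cycle_count (R : comNzRingType) (m n : nat) (A : 'M[R]_n) : R :=
  \sum_(i : {ffun 'I_m -> 'I_n} | injectiveb i)
    \prod_(s < m) A (i s) (i (ordS s)).

Definition hadamard (R : comNzRingType) p q (M N : 'M[R]_(p, q)) : 'M[R]_(p, q) :=
  \matrix_(i, j) (M i j * N i j).

(* The empty product is the all-ones matrix; it never occurs in a legal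
   pruning. *)
Definition hadamard_prod (R : comNzRingType) p q (s : seq 'M[R]_(p, q)) :
    'M[R]_(p, q) :=
  \big[@hadamard R p q/const_mx 1]_(M <- s) M.

(* Nodes are named by elements of a fixed finite type [T], of which
   [nodes] are the ones actually present, so that a node keeps its name when
   others are removed.  [(a, b, M)] is an edge directed from [a] to [b] with
   label [M]; repeated entries of [edges] are parallel edges.  For an
   undirected FAM (all edge labels symmetric) the direction in which an edge is
   stored is immaterial.  Labels [vlab a] with [a] outside [nodes] are never
   used. *)
Record fam (R : comNzRingType) (T : finType) (n : nat) := Fam {
  nodes : {set T};
  vlab : T -> 'cV[R]_n;
  edges : seq (T * T * 'M[R]_n)
}.

(* An assignment of an index to each node is encoded as a function on [T]
   taking the dummy value [ord0] outside [nodes G]. *)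
Definition full_sum (R : comNzRingType) (T : finType) n (G : fam R T n.+1) : R :=
  \sum_(j in pffun_on (ord0 : 'I_n.+1) (nodes G) predT)
    (\prod_(a in nodes G) vlab G a (j a) 0) *
    (\prod_(e <- edges G) e.2 (j e.1.1) (j e.1.2)).

Section Pruning.
Context {R : comNzRingType} {T : finType} {n : nat}.
Implicit Types (G : fam R T n) (a b p h x z : T).

Definition neighbors G a : {set T} :=
  [set b in nodes G | (b != a) &&
     has (fun e : T * T * 'M[R]_n => (e.1 == (a, b)) || (e.1 == (b, a)))
       (edges G)].

Definition typeI_pendant G p := (p \in nodes G) && (#|neighbors G p| == 1%N).
Definition typeII_pendant G p := (p \in nodes G) && (#|neighbors G p| == 2%N).
Definition pendant G p := typeI_pendant G p || typeII_pendant G p.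

(* Labels of all the edges between a and b, once aligned from a to b. *)
Definition aligned G a b : seq 'M[R]_n :=
  pmap (fun e : T * T * 'M[R]_n =>
          if e.1 == (a, b) then Some e.2
          else if e.1 == (b, a) then Some (e.2)^T
          else None)
    (edges G).

Definition edges_without G p : seq (T * T * 'M[R]_n) :=
  [seq e <- edges G | (e.1.1 != p) && (e.1.2 != p)].

Definition pruneI G p h : fam R T n :=
  {| nodes := nodes G :\ p;
     vlab := fun a =>
       if a == h
       then hadamard (vlab G h) (hadamard_prod (aligned G h p) *m vlab G p)
       else vlab G a;
     edges := edges_without G p |}.

Definition pruneII G p x z : fam R T n :=
  {| nodes := nodes G :\ p;
     vlab := vlab G;
     edges := rcons (edges_without G p)
       (x, z,
        (hadamard_prod (aligned G p x))^T *m diag_mx (vlab G p)^T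
          *m hadamard_prod (aligned G p z)) |}.

End Pruning.

(* One choice made by the algorithm: a pendant and its hinge(s); for a Type-II
   pendant it is also chosen which hinge is called x and which one z. *)
Inductive pruning_choice (T : Type) :=
  | ChooseI (p h : T)
  | ChooseII (p x z : T).

Section Algorithm.
Context {R : comNzRingType} {T : finType} {n : nat}.
Implicit Types (G : fam R T n) (c : pruning_choice T) (s : seq (pruning_choice T)).

Definition legal G c : bool :=
  match c with
  | ChooseI p h => typeI_pendant G p && (neighbors G p == [set h])
  | ChooseII p x z => typeII_pendant G p && (neighbors G p == [set x; z])
  end.

Definition prune G c : fam R T n :=
  match c with
  | ChooseI p h => pruneI G p h
  | ChooseII p x z => pruneII G p x z
  end.

Definition prune_all G s : fam R T n := foldl prune G s.

Definition can_continue G : bool :=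
  (1 < #|nodes G|)%N && [exists p, pendant G p].

(* [s] is the list of choices of a complete execution started from [G]. *)
Fixpoint complete_run G s : bool :=
  match s with
  | [::] => ~~ can_continue G
  | c :: s' => [&& can_continue G, legal G c & complete_run (prune G c) s']
  end.

(* The i-th edge is stored backwards iff the i-th bit of [o] is set; this is
   meant for undirected FAMs, so labels are not transposed. *)
Definition orient (o : bitseq) G : fam R T n :=
  {| nodes := nodes G;
     vlab := vlab G;
     edges := [seq (if be.1 then (be.2.1.2, be.2.1.1, be.2.2) else be.2)
              | be <- zip o (edges G)] |}.

End Algorithm.

(* The cyclically arranged symbols i_1, ..., i_m are the elements of ['I_m];
   the nodes of an induced FAM are named by the blocks of the partition. *)
Definition block_edges m (P : {set {set 'I_m}}) : seq ({set 'I_m} * {set 'I_m}) :=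
  [seq (pblock P s, pblock P (ordS s)) | s <- enum 'I_m].

Definition induced_fam (R : comNzRingType) m n (A : 'M[R]_n)
    (P : {set {set 'I_m}}) : fam R {set 'I_m} n :=
  {| nodes := P;
     vlab := fun _ => const_mx 1;
     edges := [seq (e, A) | e <- block_edges P] |}.

Definition self_loop_free m (P : {set {set 'I_m}}) : bool :=
  all (fun e => e.1 != e.2) (block_edges P).

Definition multiplicity m (P : {set {set 'I_m}}) (a b : {set 'I_m}) : nat :=
  count (fun e => (e == (a, b)) || (e == (b, a))) (block_edges P).

(* All labels of induced FAMs are the same, so an isomorphism is a
   bijection from P onto Q (extended to all subsets) preserving edge
   multiplicities. *)
Definition iso_induced m (P Q : {set {set 'I_m}}) : bool :=
  [exists f : {perm {set 'I_m}}, (f @: P == Q) &&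
     [forall a in P, forall b in P,
        multiplicity Q (f a) (f b) == multiplicity P a b]].

Definition inducing m k : {set {set {set 'I_m}}} :=
  [set P : {set {set 'I_m}} |
     [&& partition P [set: 'I_m], #|P| == k & self_loop_free P]].

Definition iso_classes m k : {set {set {set {set 'I_m}}}} :=
  equivalence_partition (@iso_induced m) (inducing m k).

Definition num_classes m k : nat := #|iso_classes m k|.

Definition iso_class m k (t : 'I_(num_classes m k)) : {set {set {set 'I_m}}} :=
  enum_val t.

Definition coefficient (R : comNzRingType) m k (t : 'I_(num_classes m k))
    (P : {set {set 'I_m}}) : R :=
  #|iso_class t|%:R * (-1) ^+ (m - k) * \prod_(S in P) ((#|S|.-1)`!)%:R.

Definition final_fam (R : comNzRingType) m n (A : 'M[R]_n)
    (P : {set {set 'I_m}}) (o : bitseq) (s : seq (pruning_choice {set 'I_m})) :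
    fam R {set 'I_m} n :=
  prune_all (orient o (induced_fam A P)) s.

(* Formal expressions in A and 1_n, of matrix and of vector sort.
   [MDiagPart] maps a matrix to the diagonal matrix with the same diagonal.
   There is no transposition. *)
Inductive mexpr :=
  | MA
  | MMul of mexpr & mexpr
  | MHad of mexpr & mexpr
  | MDiagPart of mexpr
  | MDiag of vexpr
with vexpr :=
  | VOne
  | VMul of mexpr & vexpr
  | VHad of vexpr & vexpr.

Section Eval.
Context {R : comNzRingType} {n : nat} (A : 'M[R]_n).

Fixpoint meval (e : mexpr) : 'M[R]_n :=
  match e with
  | MA => A
  | MMul e1 e2 => meval e1 *m meval e2
  | MHad e1 e2 => hadamard (meval e1) (meval e2)
  | MDiagPart e1 => diag_mx (\row_i meval e1 i i)
  | MDiag v => diag_mx (veval v)^T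
  end
with veval (v : vexpr) : 'cV[R]_n :=
  match v with
  | VOne => const_mx 1
  | VMul e v1 => meval e *m veval v1
  | VHad v1 v2 => hadamard (veval v1) (veval v2)
  end.

End Eval.

Definition ones_dot (R : comNzRingType) n (v : 'cV[R]_n) : R :=
  (const_mx 1 *m v : 'M_1) 0 0.

(* A scalar term in A is a function of n (shifted by one) and A; the
   expression representing it may depend on neither.  The only operation
   producing a scalar is the product of 1_n' with a vector. *)
Definition SEA_term (R : comNzRingType) (f : forall n, 'M[R]_n.+1 -> R) : Prop :=
  exists v : vexpr, forall n (A : 'M[R]_n.+1),
    sym_hollow A -> f n A = ones_dot (veval A v).

Definition layer_FS_term (R : comNzRingType) (l : nat)
    (f : forall n, 'M[R]_n.+1 -> R) : Prop :=
  exists (N : nat) (j k : 'I_N -> 'I_l) (X : 'I_N -> mexpr),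
    [/\ (0 < N)%N,
        forall s, j s = k s ->
          forall n (A : 'M[R]_n.+1), sym_hollow A -> is_diag_mx (meval A (X s))
      & forall n (A : 'M[R]_n.+1), sym_hollow A ->
          f n A = \sum_(i : {ffun 'I_l -> 'I_n.+1})
                    \prod_(s < N) meval A (X s) (i (j s)) (i (k s))].

(* Main.v *)
Require Import Defs.
From mathcomp Require Import all_boot all_order all_fingroup all_algebra.
From mathcomp Require Import reals.

Set Implicit Arguments.
Unset Strict Implicit.
Unset Printing Implicit Defensive.

Import GRing.Theory.
Local Open Scope ring_scope.

(* Pruning preserves the Full Sum because it performs the sum over the index of
   the pruned node.  It also preserves connectedness of the multigraph, so a
   final node is alone or has at least 3 neighbors.  Numbers of neighbors never
   increase, and a singleton block starts with at most 2, so in the second case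
   the surviving blocks have size at least 2, whence at most m/2 of them.

   The expansion of C_m is Moebius inversion on the partition lattice: weighting
   a partition by the product of (-1)^(|S|-1) (|S|-1)! over its blocks, the sum
   over the partitions on whose blocks a map i is constant is 1 if i is
   injective and 0 otherwise.  Isomorphic induced FAMs have the same weight
   since the degree of a block S is 2|S|. *)

(** The claims about SEA terms and layered terms quantify over all sizes and matrices at once,
    whereas a run is only known to be legal for the given [A]. The two meet because legality depends
    on the nodes and on the end points of the edges, never on the labels: the same choices are legal
    for every symmetric hollow matrix of any size, and one expression per label can be carried along
    the run. The two hypotheses on [A] act at separate places. The zero diagonal makes partitions
    with self-loops contribute 0 to the expansion. Symmetry makes orientations harmless, lets edge
    multiplicities, which forget directions, determine the Full Sum, and makes transposed labels
    expressible. *)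

Lemma big_reindex_bij (V : nmodType) (I J : finType) (P : pred I) (Q : pred J)
    (h : J -> I) (h' : I -> J) (F : I -> V) :
  (forall i, P i -> Q (h' i) /\ h (h' i) = i) ->
  (forall j, Q j -> P (h j) /\ h' (h j) = j) ->
  \sum_(i | P i) F i = \sum_(j | Q j) F (h j).
Proof.
move=> hP hQ; rewrite (reindex_onto h h') => [|i /hP[]//].
apply: eq_bigl => j; apply/andP/idP => [[/hP[Qj _] /eqP hj]|/hQ[Ph ->]].
  by rewrite hj in Qj.
by rewrite eqxx.
Qed.

(** * Moebius inversion on set partitions, by induction on the ground set *)

Section PartitionSum.
Variables (T : finType) (V : eqType) (R : comNzRingType) (i : T -> V).
Implicit Types (P Q : {set {set T}}) (B D S : {set T}).

Definition constant_on B : bool :=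
  [forall a in B, forall b in B, i a == i b].

Lemma constant_onP B :
  reflect {in B &, forall a b, i a = i b} (constant_on B).
Proof.
apply: (iffP idP) => [h a b aB bB|h].
  by apply/eqP; move/forall_inP/(_ a aB)/forall_inP/(_ b bB): h.
by apply/forall_inP => a aB; apply/forall_inP => b bB; apply/eqP/h.
Qed.

Definition constant_on_blocks P : bool := [forall B in P, constant_on B].

(** The Moebius function of the lattice of partitions of [B], taken from the finest to the coarsest
    partition. *)
Definition block_weight B : R := (-1) ^+ #|B|.-1 * (#|B|.-1)`!%:R.

(** The choice [PS.2 = set0] encodes opening the new block [[set x]], so that both ways of inserting
    [x] share one formula. *)
Definition add_to_block x (PS : {set {set T}} * {set T}) : {set {set T}} :=
  (x |: PS.2) |: (PS.1 :\ PS.2).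

(** Removing [set0] at the end discards what is left of the block of [x] when this block is
    [[set x]]. *)
Definition remove_point x Q : {set {set T}} * {set T} :=
  (((pblock Q x :\ x) |: (Q :\ pblock Q x)) :\ set0, pblock Q x :\ x).

(** Together with [remove_pointK], this gives a bijection between the partitions of [x |: D] and the
    pairs made of a partition of [D] and either one of its blocks or [set0]. *)
Lemma add_to_blockK x D P S : x \notin D ->
  partition P D -> (S \in P) || (S == set0) ->
  partition (add_to_block x (P, S)) (x |: D) /\
  remove_point x (add_to_block x (P, S)) = (P, S).
Proof.
move=> xD pP hS; have xP B : B \in P -> x \notin B.
  by move=> /(partitionS pP)/subsetP BD; apply: contra xD => /BD.
have xS : x \notin S by case/orP: hS => [/xP//|/eqP->]; rewrite inE.
have SD : S \subset D.
  by case/orP: hS => [/(partitionS pP)//|/eqP->]; rewrite sub0set.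
have pPS : partition (P :\ S) (D :\: S).
  case/orP: hS => [SP|/eqP->]; first exact: partitionD1.
  have h0 := partition0 pP.
  rewrite setD0 (_ : P :\ set0 = P) //; apply/setP => B; rewrite !inE.
  by case: eqP => [->|]//=; rewrite h0.
have pQ : partition (add_to_block x (P, S)) (x |: D).
  rewrite /add_to_block /= (_ : x |: D = (x |: S) :|: (D :\: S)).
    apply: partitionU1 => //; first by apply/set0Pn; exists x; rewrite setU11.
    rewrite disjoint_subset; apply/subsetP => y; rewrite !inE.
    by case/orP => [/eqP->|->//]; rewrite (negbTE xD) andbF.
  by rewrite -setUA setDE setUIr setUCr setIT (setUidPr SD).
split=> //; have pb : pblock (add_to_block x (P, S)) x = x |: S.
  by apply: def_pblock (partition_trivIset pQ) _ _; rewrite ?setU11.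
rewrite /remove_point pb setU1K // /add_to_block /=; congr (_, _).
have xSP : x |: S \notin P.
  by apply/negP => /xP; rewrite setU11.
rewrite setU1K; last by rewrite !inE (negbTE xSP) andbF.
apply/setP => B; rewrite !inE.
have [->|B0] /= := eqVneq B set0; first by rewrite (partition0 pP).
have [BS|//] := eqVneq B S; rewrite -BS in hS *.
by rewrite (negbTE B0) orbF in hS; rewrite hS.
Qed.

Lemma remove_pointK x D Q : x \notin D -> partition Q (x |: D) ->
  [/\ partition (remove_point x Q).1 D,
      ((remove_point x Q).2 \in (remove_point x Q).1) ||
        ((remove_point x Q).2 == set0)
    & add_to_block x (remove_point x Q) = Q].
Proof.
move=> xD pQ; set B := pblock Q x.
have xc : x \in cover Q by rewrite (cover_partition pQ) setU11.
have xB : x \in B by rewrite mem_pblock.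
have BQ : B \in Q by apply: pblock_mem.
have pQB := partitionD1 pQ BQ.
have Q0 := partition0 pQ.
have BD : B \subset x |: D := partitionS pQ BQ.
have DB : (x |: D) :\: B = D :\: (B :\ x).
  apply/setP => y; rewrite !inE; have [->|] //= := eqVneq y x.
  by rewrite xB (negbTE xD).
rewrite DB in pQB; rewrite /remove_point -/B /add_to_block /=.
have [Bx0|Bx0] := eqVneq (B :\ x) set0.
  have Bx : B = [set x] by rewrite -(setD1K xB) Bx0 setU0.
  rewrite Bx0 setD0 in pQB *.
  rewrite setU1K; last by rewrite !inE Q0 andbF.
  rewrite !orbT; split=> //.
  rewrite setU0 Bx (_ : _ :\ set0 = Q :\ [set x]) -?Bx ?setD1K //.
  by apply/setP => C; rewrite !inE; case: eqP => [->|]//=; rewrite Q0 andbF.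
have -> : (B :\ x |: Q :\ B) :\ set0 = B :\ x |: Q :\ B.
  apply/setP => C; rewrite !inE; case: eqP => //= ->.
  by rewrite Q0 eq_sym (negbTE Bx0) andbF.
rewrite !inE eqxx /=; split=> //.
  have BxD : B :\ x \subset D by rewrite subDset.
  rewrite -[D](setID _ (B :\ x)) (setIidPr BxD); apply: partitionU1 => //.
  by rewrite disjoint_subset; apply/subsetP => y; rewrite !inE => ->.
rewrite setU1K ?setD1K // !inE negb_and; apply/orP; right.
(* If [B :\ x] were itself a block, it would share [y] with the block [B], hence equal [B], which
   contains [x]. *)
apply/negP => BxQ; case/set0Pn: Bx0 => y yBx.
have yB : y \in B by case/setD1P: yBx.
have /setP/(_ x) : B :\ x = B.
  have tQ := partition_trivIset pQ.
  by rewrite -(def_pblock tQ BxQ yBx); apply: def_pblock.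
by rewrite !inE eqxx xB.
Qed.

Lemma constant_on_blocks_add x D P S : x \notin D ->
  partition P D -> (S \in P) || (S == set0) ->
  constant_on_blocks (add_to_block x (P, S)) =
    constant_on_blocks P && [forall y in S, i y == i x].
Proof.
move=> xD pP hS; rewrite /constant_on_blocks /add_to_block /=.
apply/forall_inP/andP => [h|[/forall_inP hP /forall_inP Sx] B].
  have /constant_onP hxS : constant_on (x |: S) by apply: h; rewrite setU11.
  split; apply/forall_inP; last first.
    by move=> y yS; apply/eqP/hxS; rewrite !inE ?eqxx ?yS ?orbT.
  move=> B BP; have [->|BS] := eqVneq B S; last by apply: h; rewrite !inE BS BP orbT.
  by apply/constant_onP => a b aS bS; apply: hxS; rewrite !inE ?aS ?bS orbT.
rewrite !inE => /orP[/eqP->|/andP[_ /hP//]].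
apply/constant_onP => a b; have E c : c \in x |: S -> i c = i x.
  by case/setU1P => [->//|/Sx/eqP].
by move=> /E-> /E->.
Qed.

(** As [i] is constant on each block, a block lies either inside the fiber of [i x] or outside it;
    the blocks inside partition the fiber. *)
Lemma sum_constant_blocks P D x : partition P D -> constant_on_blocks P ->
  \sum_(S in P | [forall y in S, i y == i x]) #|S|%:R =
    #|[set y in D | i y == i x]|%:R :> R.
Proof.
move=> pP /forall_inP hP.
rewrite -sum1_card (eq_bigl (fun y => (y \in D) && (i y == i x))); last first.
  by move=> y; rewrite inE.
rewrite natr_sum [RHS]big_mkcondr /= (set_partition_big _ pP) big_mkcondr /=.
apply: eq_bigr => S SP; have /constant_onP cS := hP S SP.
case: ifP => [/forall_inP h|/negbT].
  by rewrite -sum1_card natr_sum; apply: eq_bigr => y /h ->.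
rewrite negb_forall => /existsP[y]; rewrite negb_imply => /andP[yS /negbTE ny].
by rewrite big1 // => z zS; rewrite (cS z y) // ny.
Qed.

(** Enlarging a block from c > 0 to c + 1 points multiplies its weight by -c, while a new singleton
    has weight 1. *)
Lemma prod_block_weight_add x D P S : x \notin D ->
  partition P D -> (S \in P) || (S == set0) ->
  \prod_(B in add_to_block x (P, S)) block_weight B =
    (\prod_(B in P) block_weight B) * (if S == set0 then 1 else - #|S|%:R).
Proof.
move=> xD pP hS; rewrite /add_to_block /= big_setU1 /=; last first.
  rewrite !inE negb_and; apply/orP; right; apply/negP.
  by move=> /(partitionS pP)/subsetP/(_ x); rewrite setU11 (negbTE xD) => /(_ isT).
have xS : x \notin S.
  case/orP: hS => [/(partitionS pP)/subsetP h|/eqP->]; last by rewrite inE.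
  by apply: contra xD => /h.
rewrite {1}/block_weight cardsU1 xS /=.
case: eqP hS => [->|/eqP S0].
  rewrite cards0 expr0 !mul1r mulr1 => _; apply: eq_bigl => B; rewrite !inE.
  by case: eqP => [->|]//=; rewrite (partition0 pP).
rewrite orbF => SP; rewrite (big_setD1 S SP) /= {2}/block_weight.
have : (0 < #|S|)%N by rewrite card_gt0.
case: #|S| => // c _; rewrite add0n /= factS natrM exprS.
rewrite mulN1r !mulNr mulrN [_.+1%:R * _]mulrC !mulrA; congr (- _).
exact: mulrAC.
Qed.

(* Adding a point x to the ground set multiplies the sum by
   1 - #{y | i y = i x}, where 1 comes from the new block [set x] and each old
   block B with i = i x on B contributes -#|B|.  The factor is 1 or 0 as long
   as i is injective on the previous points. *)
Lemma sum_partitions_injective D :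
  \sum_(P | partition P D && constant_on_blocks P) \prod_(B in P) block_weight B
    = (dinjectiveb i D)%:R :> R.
Proof.
have [c] := ubnP #|D|; elim: c D => // c IH D /ltnSE leDc.
have [->|[x xD]] := set_0Vmem D.
  have c0 : constant_on_blocks set0 by apply/forall_inP => B; rewrite inE.
  rewrite (big_pred1 set0) => [|P]; last first.
    by rewrite partition_set0 /=; case: eqP => [->|].
  rewrite big_set0 (_ : dinjectiveb i set0) //.
  by apply/dinjectiveP => a b; rewrite inE.
have [D' [xD' DE]] : exists D', x \notin D' /\ D = x |: D'.
  by exists (D :\ x); rewrite setD1K // !inE eqxx.
rewrite {D xD}DE in leDc *; rewrite cardsU1 xD' in leDc.
pose ok (PS : {set {set T}} * {set T}) :=
  [&& partition PS.1 D', constant_on_blocks PS.1,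
      (PS.2 \in PS.1) || (PS.2 == set0) & [forall y in PS.2, i y == i x]].
rewrite (@big_reindex_bij _ _ _ _ ok (add_to_block x) (remove_point x)); first last.
- move=> [P S] /and4P[/= pP cP hS hx].
  have [-> ->] := add_to_blockK xD' pP hS.
  by rewrite (constant_on_blocks_add xD' pP hS) cP.
- move=> Q /andP[pQ cQ]; have [p1 p2 p3] := remove_pointK xD' pQ.
  split=> //; move: cQ p1 p2; rewrite -{1}p3 /ok {p3}.
  case: (remove_point x Q) => P S /= cQ p1 p2; rewrite p1 p2.
  by rewrite (constant_on_blocks_add xD' p1 p2) in cQ.
transitivity (\sum_(P | partition P D' && constant_on_blocks P)
   \sum_(S | ((S \in P) || (S == set0)) && [forall y in S, i y == i x])
     (\prod_(B in P) block_weight B) * (if S == set0 then 1 else - #|S|%:R)).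
  rewrite pair_big_dep /=; apply: eq_big => [[P S]|[P S] /and4P[/= pP cP hS _]].
    by rewrite /ok /= -andbA.
  by rewrite (prod_block_weight_add xD' pP hS).
transitivity (\sum_(P | partition P D' && constant_on_blocks P)
   (\prod_(B in P) block_weight B) * (1 - #|[set y in D' | i y == i x]|%:R : R)).
  apply: eq_bigr => P /andP[pP cP]; rewrite -mulr_sumr; congr (_ * _).
  rewrite (bigD1 set0) /=; last first.
    by rewrite eqxx orbT; apply/forall_inP => y; rewrite inE.
  rewrite eqxx -(sum_constant_blocks x pP cP) -sumrN; congr (_ + _).
  apply: eq_big => [S|S /andP[_ /negbTE->]//].
  case: eqP => [->|_]; last by rewrite orbF andbT.
  by rewrite andbF (partition0 pP).
rewrite -mulr_suml IH // {IH}.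
case: (boolP (dinjectiveb i D')) => [/dinjectiveP inj|ninj]; last first.
  rewrite mul0r; case: dinjectiveP => // inj; case/dinjectiveP: ninj.
  by apply: sub_in2 inj => y yD; rewrite inE yD orbT.
rewrite mul1r; case: dinjectiveP => [inj'|ninj'].
  rewrite (_ : [set y in D' | i y == i x] = set0) ?cards0 ?subr0 //.
  apply/setP => y; rewrite !inE; apply/negP => /andP[yD /eqP yx].
  by move: xD'; rewrite -(inj' y x _ _ yx) ?yD // !inE ?eqxx ?yD ?orbT.
have [[y0 y0D y0x]|no] := altP (@exists_inP _ (mem D') (fun y => i y == i x)).
  rewrite (_ : [set y in D' | i y == i x] = [set y0]) ?cards1 ?subrr //.
  apply/setP => y; rewrite !inE; apply/andP/eqP => [[yD yx]|->//].
  by apply: inj => //; rewrite (eqP yx) (eqP y0x).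
case: ninj' => a b /setU1P[->|aD] /setU1P[->|bD] // eab.
- by case/exists_inP: no; exists b => //; apply/eqP.
- by case/exists_inP: no; exists a => //; apply/eqP.
- exact: inj.
Qed.

End PartitionSum.

(** * Invariance of the Full Sum under pruning *)

Section FullSum.
Variables (R : comNzRingType) (T : finType) (n : nat).
Implicit Types (G : fam R T n.+1) (p q h x z a b : T) (N : {set T}).
Implicit Types (j : {ffun T -> 'I_n.+1}).

Definition joins m p q (e : T * T * 'M[R]_m) : bool :=
  (e.1 == (p, q)) || (e.1 == (q, p)).

Definition well_formed m (G : fam R T m) : bool :=
  all (fun e : T * T * 'M[R]_m =>
    [&& e.1.1 \in nodes G, e.1.2 \in nodes G & e.1.1 != e.1.2]) (edges G).

Definition edge_weight j (e : T * T * 'M[R]_n.+1) : R :=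
  e.2 (j e.1.1) (j e.1.2).

Lemma mem_pffun_ord0 N j :
  reflect (forall a, a \notin N -> j a = ord0)
          (j \in pffun_on (ord0 : 'I_n.+1) N predT).
Proof. by apply: (iffP pffun_onP) => [[/supportP]|h]//; split=> //; apply/supportP. Qed.

(** An assignment on [N] is an assignment on [N :\ p], which has the dummy value at [p], overridden
    there by a free index [c]. *)
Lemma sum_pffun_setD1 N p (F : {ffun T -> 'I_n.+1} -> R) : p \in N ->
  \sum_(j in pffun_on ord0 N predT) F j =
  \sum_(j in pffun_on ord0 (N :\ p) predT)
    \sum_(c : 'I_n.+1) F [ffun a => if a == p then c else j a].
Proof.
move=> pN; rewrite pair_big_dep /=.
rewrite (@big_reindex_bij _ _ _ _
  (fun jc : {ffun T -> 'I_n.+1} * 'I_n.+1 =>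
     (jc.1 \in pffun_on ord0 (N :\ p) predT) && true)
  (fun jc => [ffun a => if a == p then jc.2 else jc.1 a])
  (fun j => ([ffun a => if a == p then ord0 else j a], j p))) //.
- move=> j /mem_pffun_ord0 hj; split; last first.
    by apply/ffunP => a; rewrite !ffunE; case: eqP => [->|].
  rewrite andbT; apply/mem_pffun_ord0 => a /=.
  by rewrite !inE ffunE; case: eqP => //= _ /hj.
- move=> [j c]; rewrite andbT => /mem_pffun_ord0 /= hj; split.
    apply/mem_pffun_ord0 => a aN; rewrite ffunE.
    case: eqP aN => [->|_ aN]; first by rewrite pN.
    by apply: hj; rewrite !inE (negbTE aN) andbF.
  congr (_, _); last by rewrite ffunE eqxx.
  apply/ffunP => a; rewrite !ffunE; case: eqP => // ->.
  by rewrite hj // !inE eqxx.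
Qed.

Lemma neighborsP m (G : fam R T m) a b :
  reflect [/\ b \in nodes G, b != a & has (joins a b) (edges G)]
          (b \in neighbors G a).
Proof. by rewrite inE; apply: and3P. Qed.

(** Alignment transposes the label of a reversed edge, so each factor is the weight of the edge as
    stored, whatever its direction. *)
Lemma hadamard_prod_aligned G p q j : p != q ->
  hadamard_prod (aligned G p q) (j p) (j q) =
    \prod_(e <- edges G | joins p q e) edge_weight j e.
Proof.
move=> pq; rewrite /hadamard_prod /aligned.
elim: (edges G) => [|[[a b] M] E IH]; first by rewrite !big_nil mxE.
rewrite /= big_cons /joins /= -/joins; have [[-> ->]|nab] := eqVneq (a, b) (p, q).
  by rewrite /= big_cons mxE IH.
have [[-> ->]|] //= := eqVneq (a, b) (q, p).
by rewrite big_cons mxE IH /edge_weight mxE.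
Qed.

Lemma incident_joins m (G : fam R T m) p e : well_formed G -> e \in edges G ->
  (e.1.1 == p) || (e.1.2 == p) ->
  exists2 q, q \in neighbors G p & joins p q e.
Proof.
move=> /allP wf eE; have /and3P[n1 n2 n12] := wf e eE.
case/orP => /eqP ep; rewrite -ep.
  exists e.1.2; last by rewrite /joins -surjective_pairing eqxx.
  apply/neighborsP; split=> //; first by rewrite eq_sym.
  by apply/hasP; exists e => //; rewrite /joins -surjective_pairing eqxx.
exists e.1.1; last by rewrite /joins -surjective_pairing eqxx orbT.
apply/neighborsP; split=> //.
by apply/hasP; exists e => //; rewrite /joins -surjective_pairing eqxx orbT.
Qed.

Lemma prod_edges_without G p j :
  \prod_(e <- edges G) edge_weight j e =
    (\prod_(e <- edges_without G p) edge_weight j e) *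
    \prod_(e <- edges G | (e.1.1 == p) || (e.1.2 == p)) edge_weight j e.
Proof.
rewrite big_filter (bigID (fun e => (e.1.1 != p) && (e.1.2 != p))) /=.
by congr (_ * _); apply: eq_bigl => e; rewrite negb_and !negbK.
Qed.

Lemma joins_incident m p q (e : T * T * 'M[R]_m) :
  joins p q e -> (e.1.1 == p) || (e.1.2 == p).
Proof. by case: e => [[a b] M] /orP[] /eqP[-> ->]; rewrite eqxx ?orbT. Qed.

(** Everything that does not involve the index of [p] is pulled out; the inner sum over [c] is what
    a pruning turns into a label. *)
Lemma full_sum_setD1 G p : p \in nodes G ->
  full_sum G = \sum_(j in pffun_on ord0 (nodes G :\ p) predT)
    (\prod_(a in nodes G :\ p) vlab G a (j a) 0) *
    (\prod_(e <- edges_without G p) edge_weight j e) *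
    \sum_(c : 'I_n.+1)
      let jc := [ffun a => if a == p then c else j a] in
      vlab G p c 0 *
      \prod_(e <- edges G | (e.1.1 == p) || (e.1.2 == p)) edge_weight jc e.
Proof.
move=> pG; rewrite /full_sum (sum_pffun_setD1 _ pG); apply: eq_bigr => j _.
rewrite mulr_sumr; apply: eq_bigr => c _ /=.
rewrite (big_setD1 _ pG) /= ffunE eqxx (prod_edges_without G p).
rewrite (eq_bigr (fun a => vlab G a (j a) 0)); last first.
  by move=> a; rewrite !inE ffunE => /andP[/negbTE->].
set jc := finfun _.
have -> : \prod_(e <- edges_without G p) edge_weight j e =
    \prod_(e <- edges_without G p) edge_weight jc e.
  apply: eq_big_seq => e; rewrite mem_filter => /andP[/andP[/negbTE e1 /negbTE e2] _].
  by rewrite /edge_weight !ffunE e1 e2.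
by rewrite -!mulrA mulrCA; congr (_ * _); rewrite mulrCA.
Qed.

Lemma full_sum_pruneI G p h : well_formed G -> legal G (ChooseI p h) ->
  full_sum (pruneI G p h) = full_sum G.
Proof.
move=> wf /andP[/andP[pG _] /eqP Np].
have /neighborsP[hG hp _] : h \in neighbors G p by rewrite Np set11.
rewrite (full_sum_setD1 pG) /full_sum /=; apply: eq_bigr => j _.
have hGp : h \in nodes G :\ p by rewrite !inE hp.
rewrite !(big_setD1 _ hGp) /= eqxx mxE -/edge_weight.
rewrite (eq_bigr (fun a => vlab G a (j a) 0)); last first.
  by move=> a; rewrite !inE => /andP[/negbTE->].
(* All edges at [p] go to [h], so [S] depends on [j h] alone: it is the entry at [j h] of the vector
   multiplied into the label of [h]. *)
set S := \sum_(c < _) _; rewrite (_ : (_ *m _) _ _ = S).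
  by rewrite -!mulrA; congr (_ * _); rewrite mulrC -mulrA.
rewrite mxE; apply: eq_bigr => c _ /=; rewrite mulrC; congr (_ * _).
set jc := [ffun _ => _].
rewrite (_ : hadamard_prod _ _ _ = hadamard_prod (aligned G h p) (jc h) (jc p));
  last by rewrite !ffunE eqxx (negbTE hp).
rewrite hadamard_prod_aligned // big_seq_cond [RHS]big_seq_cond; apply: eq_bigl => e.
have [eE|//] /= := boolP (e \in edges G).
apply/idP/idP => [hpe|inc].
  by apply: (@joins_incident _ p h); move: hpe; rewrite /joins orbC.
have [q] := incident_joins wf eE inc.
by rewrite Np inE => /eqP->; rewrite /joins orbC.
Qed.

(** The inner sum over the index of [p] is the entry at [(j x, j z)] of the matrix product that
    labels the new edge. *)
Lemma full_sum_pruneII G p x z : well_formed G -> legal G (ChooseII p x z) ->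
  full_sum (pruneII G p x z) = full_sum G.
Proof.
move=> wf /andP[/andP[pG N2] /eqP Np].
have xz : x != z by move: N2; rewrite Np cards2; case: (x != z).
have /neighborsP[xG xp _] : x \in neighbors G p by rewrite Np set21.
have /neighborsP[zG zp _] : z \in neighbors G p by rewrite Np set22.
rewrite (full_sum_setD1 pG) /full_sum /=; apply: eq_bigr => j _.
rewrite big_rcons /= -!mulrA; congr (_ * _); congr (_ * _).
rewrite mxE; apply: eq_bigr => c _ /=.
rewrite mul_mx_diag !mxE mulrAC mulrC; congr (_ * _).
set jc := [ffun _ => _].
have jcE : [/\ jc p = c, jc x = j x & jc z = j z].
  by rewrite !ffunE eqxx (negbTE xp) (negbTE zp).
have -> : hadamard_prod (aligned G p x) c (j x) =
    \prod_(e <- edges G | joins p x e) edge_weight jc e.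
  by case: jcE => {1}<- <- _; rewrite hadamard_prod_aligned // eq_sym.
have -> : hadamard_prod (aligned G p z) c (j z) =
    \prod_(e <- edges G | joins p z e) edge_weight jc e.
  by case: jcE => {1}<- _ <-; rewrite hadamard_prod_aligned // eq_sym.
(* The edges at [p] are split into those that join [x] and the others. The latter join [z], the only
   other hinge, and no edge joins [p] to both since [x != z]. *)
rewrite [RHS](bigID (joins p x)) /=; congr (_ * _); rewrite big_seq_cond [RHS]big_seq_cond;
  apply: eq_bigl => e; have [eE|//] /= := boolP (e \in edges G).
  by apply/idP/andP => [h|[]//]; split=> //; apply: joins_incident h.
apply/idP/andP => [h|[inc nx]].
  split; first exact: joins_incident h.
  apply: contra xz; case: (e) h => [[a b] M] /=; rewrite /joins /=.
  by case/orP=> /eqP[-> ->]; rewrite !xpair_eqE eqxx (negbTE zp)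
    ?andbF ?andbT /= ?orbF 1?eq_sym.
have [q] := incident_joins wf eE inc.
by rewrite Np !inE => /orP[]/eqP-> //; rewrite (negbTE nx).
Qed.

Lemma full_sum_prune G c : well_formed G -> legal G c ->
  full_sum (prune G c) = full_sum G.
Proof.
by case: c => [p h|p x z]; [apply: full_sum_pruneI|apply: full_sum_pruneII].
Qed.

End FullSum.

(** * Connectedness and neighbor counts along a run *)

Section PruningInvariants.
Variables (R : comNzRingType) (T : finType) (n : nat).
Implicit Types (G : fam R T n.+1) (p q h x z a b : T) (X : {set T}).

(** Connectedness is stated through cuts: a single crossing edge is easily followed through a
    pruning, while a path would have to be rerouted around the removed node. *)
Definition cut_connected G : Prop := forall X, X \subset nodes G -> X != set0 ->
  X != nodes G ->
  has (fun e : T * T * 'M[R]_n.+1 => (e.1.1 \in X) != (e.1.2 \in X)) (edges G).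

Lemma cut_connected_neighbors G a : well_formed G -> cut_connected G ->
  (1 < #|nodes G|)%N -> a \in nodes G -> neighbors G a != set0.
Proof.
move=> wf cc N1 aG; have /hasP[e eE he] : has (fun e : T * T * 'M[R]_n.+1 =>
    (e.1.1 \in [set a]) != (e.1.2 \in [set a])) (edges G).
  apply: cc; first by rewrite sub1set.
    by apply/set0Pn; exists a; rewrite set11.
  by apply: contraTneq N1 => <-; rewrite cards1.
have inc : (e.1.1 == a) || (e.1.2 == a).
  by move: he; rewrite !inE; case: (e.1.1 == a) (e.1.2 == a) => [] [].
by have [q qa _] := incident_joins wf eE inc; apply/set0Pn; exists q.
Qed.

Lemma hinge_neighbor G c : legal G c ->
  match c with
  | ChooseI p h => [/\ p \in nodes G, h \in nodes G, h != p & neighbors G p = [set h]]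
  | ChooseII p x z =>
      [/\ p \in nodes G, x \in nodes G :\ p, z \in nodes G :\ p, x != z
        & neighbors G p = [set x; z]]
  end.
Proof.
case: c => [p h|p x z] /= /andP[/andP[pG N2] /eqP Np].
  by have /neighborsP[hG hp _] : h \in neighbors G p by rewrite Np set11.
have /neighborsP[xG xp _] : x \in neighbors G p by rewrite Np set21.
have /neighborsP[zG zp _] : z \in neighbors G p by rewrite Np set22.
split=> //; rewrite ?inE ?xp ?zp //.
by move: N2; rewrite Np cards2; case: (x != z).
Qed.

Lemma well_formed_prune G c : well_formed G -> legal G c ->
  well_formed (prune G c).
Proof.
move=> wf lc; have wo p : all (fun e : T * T * 'M[R]_n.+1 =>
    [&& e.1.1 \in nodes G :\ p, e.1.2 \in nodes G :\ p & e.1.1 != e.1.2])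
    (edges_without G p).
  apply/allP => e; rewrite mem_filter => /andP[/andP[e1 e2] /(allP wf)/and3P[h1 h2 h3]].
  by rewrite !inE e1 e2 h1 h2.
case: c lc (hinge_neighbor lc) => [p h|p x z] _ /=; first by move=> _; apply: wo.
by case=> _ xG zG xz _; rewrite /well_formed /= all_rcons /= xG zG xz; apply: wo.
Qed.

Lemma prune_neq0 G c : legal G c -> nodes (prune G c) != set0.
Proof.
move=> lc; case: c lc (hinge_neighbor lc) => [p h|p x z] _ /=.
  by case=> _ hG hp _; apply/set0Pn; exists h; rewrite !inE hp.
by case=> _ xG _ _ _; apply/set0Pn; exists x.
Qed.

Lemma nodes_prune_sub G c : nodes (prune G c) \subset nodes G.
Proof. by case: c => [p h|p x z]; apply: subsetDl. Qed.

Lemma cut_connected_prune G c : well_formed G -> legal G c -> cut_connected G ->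
  cut_connected (prune G c).
Proof.
(* An edge of G crossing the cut survives the pruning of p as soon as p is put
   on the same side as its hinges; if the hinges are on different sides, then
   the edge created by the pruning crosses the cut. *)
move=> wf lc cc X XG' X0 XN.
have [p pE [pG XGp XNp]] : exists2 p,
    nodes (prune G c) = nodes G :\ p &
    [/\ p \in nodes G, X \subset nodes G :\ p & X != nodes G :\ p].
  case: c lc XG' XN => [p h|p x z] lc XG' XN; exists p => //; split=> //;
  by case: (hinge_neighbor lc).
have XG : X \subset nodes G := subset_trans XGp (subsetDl _ _).
have pX : p \notin X by apply/negP => /(subsetP XGp); rewrite !inE eqxx.
have XnG : X != nodes G by apply: contraNneq pX => ->.
have pXG : p |: X \subset nodes G by rewrite subUset sub1set pG.
have pXN : p |: X != nodes G by apply: contraNneq XNp => <-; rewrite setU1K.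
have pX0 : p |: X != set0 by apply/set0Pn; exists p; rewrite setU11.
have key (Y : {set T}) : Y \subset nodes G -> Y != set0 -> Y != nodes G ->
    Y = X \/ Y = p |: X ->
    (forall q, q \in neighbors G p -> (q \in Y) = (p \in Y)) ->
    has (fun e : T * T * 'M[R]_n.+1 => (e.1.1 \in X) != (e.1.2 \in X))
      (edges_without G p).
  move=> YG Y0 YN YX side; have /hasP[e eE he] := cc Y YG Y0 YN.
  have /norP[e1 e2] : ~~ ((e.1.1 == p) || (e.1.2 == p)).
    apply: contra he => inc; have [q /side qp] := incident_joins wf eE inc.
    by case: (e) => [[a b] M] /orP[] /eqP[-> ->]; rewrite qp.
  apply/hasP; exists e; first by rewrite mem_filter e1 e2.
  by case: YX he => [->//|->]; rewrite !inE (negbTE e1) (negbTE e2).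
case: c lc pE {XG' XN} => [p' h|p' x z] lc /= pE.
  (* [p] came out of an existential and is identified again: it is the node whose removal leaves the
     nodes of the pruned FAM. *)
  have pp : p' = p.
    case: (hinge_neighbor lc) => p'G _ _ _; apply/eqP/negP => /negP np.
    by move/setP/(_ p'): pE; rewrite !inE eqxx np p'G.
  rewrite pp in lc *; case: (hinge_neighbor lc) => _ hG hp Np.
  have [hX|hX] := boolP (h \in X).
    apply: (key (p |: X)) => //; first by right.
    by move=> q; rewrite Np inE => /eqP->; rewrite !inE hX eqxx orbT.
  apply: (key X) => //; first by left.
  by move=> q; rewrite Np inE => /eqP->; rewrite (negbTE hX) (negbTE pX).
have pp : p' = p.
  case: (hinge_neighbor lc) => p'G _ _ _ _; apply/eqP/negP => /negP np.
  by move/setP/(_ p'): pE; rewrite !inE eqxx np p'G.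
rewrite pp in lc *; case: (hinge_neighbor lc) => _ xG zG xz Np.
rewrite has_rcons /=; have [xzX|//] /= := eqVneq (x \in X) (z \in X).
have [hX|hX] := boolP (x \in X).
  apply: (key (p |: X)) => //; first by right.
  by move=> q; rewrite Np !inE => /orP[] /eqP->; rewrite -?xzX hX eqxx orbT.
apply: (key X) => //; first by left.
by move=> q; rewrite Np !inE => /orP[] /eqP->; rewrite -?xzX (negbTE hX) (negbTE pX).
Qed.

(** The only adjacency that a pruning can create is between the two hinges of a Type-II pendant, and
    each of them loses the neighbor [p] in exchange. *)
Lemma card_neighbors_prune G c a : legal G c ->
  (#|neighbors (prune G c) a| <= #|neighbors G a|)%N.
Proof.
move=> lc; have wo p b : b \in nodes G :\ p -> b != a ->
    has (joins a b) (edges_without G p) -> b \in neighbors G a.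
  move=> /setD1P[_ bG] ba /hasP[e]; rewrite mem_filter => /andP[_ eE] je.
  by apply/neighborsP; split=> //; apply/hasP; exists e.
case: c lc => [p h|p x z] lc.
  by apply/subset_leq_card/subsetP => b /neighborsP[b1 b2 b3]; apply: wo b1 b2 b3.
have [pG xG zG xz Np] := hinge_neighbor lc.
have sub b : b \in neighbors (prune G (ChooseII p x z)) a ->
    b \in neighbors G a \/ (a, b) = (x, z) \/ (a, b) = (z, x).
  case/neighborsP => bG ba; rewrite /= has_rcons => /orP[je|]; last first.
    by move=> h; left; apply: wo bG ba h.
  right; move: je; rewrite /joins /=.
  by case/orP => /eqP[-> ->]; [left|right].
have swap q : q \in neighbors G p -> p \in neighbors G q.
  move=> /neighborsP[qG qp /hasP[e eE je]]; apply/neighborsP; split=> //.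
    by rewrite eq_sym.
  by apply/hasP; exists e => //; rewrite /joins orbC.
have pn b : b \in neighbors (prune G (ChooseII p x z)) a -> b != p.
  by case/neighborsP => /setD1P[].
have card q : (forall b, b \in neighbors (prune G (ChooseII p x z)) a ->
    b \in neighbors G a \/ b = q) -> p \in neighbors G a ->
    (#|neighbors (prune G (ChooseII p x z)) a| <= #|neighbors G a|)%N.
  move=> hq pa; rewrite (cardsD1 p (neighbors G a)) pa add1n.
  apply: leq_trans (_ : #|q |: (neighbors G a :\ p)| <= _)%N.
    apply/subset_leq_card/subsetP => b hb.
    rewrite in_setU1 in_setD1 (pn b hb).
    by case: (hq b hb) => ->; rewrite ?orbT ?eqxx.
  by rewrite cardsU1; case: (_ \notin _).
have [ax|ax] := eqVneq a x.
  apply: (card z); last by apply: swap; rewrite Np ax set21.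
  move=> b /sub[|[|]]; [by left|by case=> _ ->; right|].
  by rewrite ax => -[xz' _]; rewrite xz' eqxx in xz.
have [az|az] := eqVneq a z.
  apply: (card x); last by apply: swap; rewrite Np az set22.
  move=> b /sub[|[|]]; [by left| |by case=> _ ->; right].
  by rewrite az => -[xz' _]; rewrite xz' eqxx in xz.
apply/subset_leq_card/subsetP => b /sub[//|[][e _]].
  by rewrite e eqxx in ax.
by rewrite e eqxx in az.
Qed.

(** The last clause compares with the initial FAM: it lets the number of final nodes be bounded
    through the sizes of the original blocks. *)
Definition pruning_invariant G0 G : Prop :=
  [/\ well_formed G, cut_connected G, full_sum G = full_sum G0,
      nodes G != set0 &
      nodes G \subset nodes G0 /\
      (forall a, (#|neighbors G a| <= #|neighbors G0 a|)%N)].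

Lemma complete_run_invariant G s : well_formed G -> cut_connected G ->
  nodes G != set0 -> complete_run G s ->
  pruning_invariant G (prune_all G s) /\ ~~ can_continue (prune_all G s).
Proof.
move=> wf cc G0; have inv0 : pruning_invariant G G by split.
suff run1 G1 : pruning_invariant G G1 -> complete_run G1 s ->
    pruning_invariant G (prune_all G1 s) /\ ~~ can_continue (prune_all G1 s).
  exact: run1.
elim: s G1 => [|c s IH] G1 inv //= /and3P[_ lc run].
apply: IH run; case: inv => wf1 cc1 fs1 _ [sub1 nb1].
split.
- exact: well_formed_prune.
- exact: cut_connected_prune.
- by rewrite full_sum_prune.
- exact: prune_neq0.
split; first exact: subset_trans (nodes_prune_sub _ _) sub1.
by move=> a; apply: leq_trans (card_neighbors_prune _ lc) (nb1 a).
Qed.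

Lemma full_sum_set1 G p : well_formed G -> nodes G = [set p] ->
  full_sum G = ones_dot (vlab G p).
Proof.
move=> /allP wf Gp; have E0 : edges G = [::].
  case: (edges G) wf => // e E /(_ e); rewrite inE eqxx => /(_ isT).
  by rewrite Gp !inE /= => /and3P[/eqP-> /eqP->]; rewrite eqxx.
rewrite /full_sum Gp E0 (@sum_pffun_setD1 _ _ _ _ p) ?set11 // setDv.
rewrite (big_pred1 [ffun => ord0]) => [|j]; last first.
  apply/mem_pffun_ord0/eqP => [h|-> a _]; last by rewrite ffunE.
  by apply/ffunP => a; rewrite ffunE h ?inE.
rewrite /ones_dot mxE; apply: eq_bigr => c _.
by rewrite big_set1 big_nil ffunE eqxx !mxE mul1r mulr1.
Qed.

(** Connectedness excludes a node without neighbors, and the absence of pendants excludes one or two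
    neighbors. A node and its neighbors then make at least four. *)
Lemma no_pendant_card G : well_formed G -> cut_connected G ->
  (1 < #|nodes G|)%N -> (forall p, ~~ pendant G p) ->
  (4 <= #|nodes G|)%N /\ (forall a, a \in nodes G -> (3 <= #|neighbors G a|)%N).
Proof.
move=> wf cc N1 np; have n3 a : a \in nodes G -> (3 <= #|neighbors G a|)%N.
  move=> aG; have := cut_connected_neighbors wf cc N1 aG.
  rewrite -card_gt0; move: (np a); rewrite /pendant /typeI_pendant /typeII_pendant aG.
  by case: #|_| => [|[|[|]]].
split=> //; have [a aG] : exists a, a \in nodes G.
  by apply/set0Pn; rewrite -card_gt0 ltnW.
rewrite (cardsD1 a) aG; apply: leq_trans (n3 a aG) (subset_leq_card _).
by apply/subsetP => b /neighborsP[bG ba _]; rewrite !inE ba.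
Qed.

End PruningInvariants.

(** * Labels as expressions valid for all sizes and matrices *)

Section SymbolicLabels.
Variables (R : comNzRingType) (T : finType).
Implicit Types (e : mexpr) (l : seq mexpr) (N : {set T}) (V : T -> vexpr).
Implicit Types (E : seq (T * T * mexpr)) (F : forall n, 'M[R]_n.+1 -> fam R T n.+1).

(* Expressions have no transposition, but over a symmetric A they are closed
   under it: products are reversed. *)
Fixpoint mexpr_tr e : mexpr :=
  match e with
  | MA => MA
  | MMul e1 e2 => MMul (mexpr_tr e2) (mexpr_tr e1)
  | MHad e1 e2 => MHad (mexpr_tr e1) (mexpr_tr e2)
  | MDiagPart e1 => MDiagPart e1
  | MDiag v => MDiag v
  end.

Lemma meval_tr n (A : 'M[R]_n) e : A^T = A -> meval A (mexpr_tr e) = (meval A e)^T.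
Proof.
move=> As; elim: e => //= [e1 IH1 e2 IH2|e1 IH1 e2 IH2|e IH|v].
- by rewrite trmx_mul IH1 IH2.
- by apply/matrixP => a b; rewrite IH1 IH2 !mxE.
- by rewrite tr_diag_mx.
- by rewrite tr_diag_mx.
Qed.

(** A head and a tail are taken because the grammar has no constructor for the all-ones matrix, the
    value of [hadamard_prod] on an empty list. *)
Fixpoint mexpr_hadamard e l : mexpr :=
  if l is e' :: l' then MHad e (mexpr_hadamard e' l') else e.

Lemma meval_hadamard n (A : 'M[R]_n) e l :
  meval A (mexpr_hadamard e l) = hadamard_prod (meval A e :: map (meval A) l).
Proof.
rewrite /hadamard_prod; elim: l e => [|e' l IH] e /=; rewrite big_cons.
  by rewrite big_nil; apply/matrixP => a b; rewrite !mxE mulr1.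
by rewrite IH.
Qed.

Definition labels_given_by n (A : 'M[R]_n.+1) (G : fam R T n.+1) N V E : Prop :=
  [/\ nodes G = N, forall a, vlab G a = veval A (V a)
    & edges G = [seq (x.1, meval A x.2) | x <- E]].

(** One symbolic FAM, chosen before [n] and [A], describes the whole family, since the expressions
    of the conclusion may depend on neither. *)
Definition expressible F : Prop :=
  exists N V E, forall n (A : 'M[R]_n.+1), sym_hollow A ->
    labels_given_by A (F n A) N V E.

Definition mexpr_aligned E a b : seq mexpr :=
  pmap (fun x : T * T * mexpr =>
          if x.1 == (a, b) then Some x.2
          else if x.1 == (b, a) then Some (mexpr_tr x.2) else None) E.

(** [MA] is a dummy value for an empty bundle; a pendant and its hinge are always joined by an
    edge. *)
Definition mexpr_bundle E a b : mexpr :=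
  if mexpr_aligned E a b is e :: l then mexpr_hadamard e l else MA.

Lemma meval_bundle n (A : 'M[R]_n.+1) G N V E a b : sym_hollow A ->
  labels_given_by A G N V E -> has (joins a b) (edges G) ->
  meval A (mexpr_bundle E a b) = hadamard_prod (aligned G a b).
Proof.
move=> [As _] [_ _ EG].
have alE : aligned G a b = map (meval A) (mexpr_aligned E a b).
  rewrite /aligned EG; elim: E {EG} => //= x E IH.
  by case: ifP => _ /=; [rewrite IH|case: ifP => _ /=; rewrite IH ?meval_tr].
have has_al : has (joins a b) (edges G) -> aligned G a b != [::].
  by rewrite /aligned; elim: (edges G) => //= x s IH; rewrite /joins -/joins;
    case: ifP => //=; case: ifP.
move=> /has_al; rewrite alE /mexpr_bundle; case: mexpr_aligned => //= e l _.
by rewrite meval_hadamard.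
Qed.

Lemma edges_without_map n (A : 'M[R]_n.+1) (G : fam R T n.+1) p E :
  edges G = [seq (x.1, meval A x.2) | x <- E] ->
  edges_without G p = [seq (x.1, meval A x.2)
    | x <- [seq x : T * T * mexpr <- E | (x.1.1 != p) && (x.1.2 != p)]].
Proof. by move=> eG; rewrite /edges_without eG filter_map. Qed.

(** The sizes may differ: this carries a run for one matrix over to matrices of every size. *)
Lemma legal_same_shape n n' (G : fam R T n) (G' : fam R T n') c :
  nodes G = nodes G' -> map fst (edges G) = map fst (edges G') ->
  legal G c = legal G' c.
Proof.
move=> nG eG; have nb a : neighbors G a = neighbors G' a.
  apply/setP => b; rewrite !inE nG; congr (_ && (_ && _)).
  have H m (H : fam R T m) : has (fun e : T * T * 'M[R]_m =>
      (e.1 == (a, b)) || (e.1 == (b, a))) (edges H)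
    = has (fun k => (k == (a, b)) || (k == (b, a))) (map fst (edges H)).
    by rewrite has_map; apply: eq_has.
  by rewrite !H eG.
by case: c => [p h|p x z]; rewrite /legal /typeI_pendant /typeII_pendant nG nb.
Qed.

Lemma expressible_prune F n0 (A0 : 'M[R]_n0.+1) c : sym_hollow A0 ->
  expressible F -> legal (F n0 A0) c -> expressible (fun n A => prune (F n A) c).
Proof.
move=> hA0 [N [V [E hF]]] lc0.
have {lc0} lc n (A : 'M[R]_n.+1) : sym_hollow A -> legal (F n A) c.
  move=> hA; rewrite (legal_same_shape (G' := F n0 A0)) //.
    by have [-> _ _] := hF n A hA; have [-> _ _] := hF n0 A0 hA0.
  have [_ _ ->] := hF n A hA; have [_ _ ->] := hF n0 A0 hA0.
  by rewrite -!map_comp; apply: eq_map.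
have joined m (G : fam R T m.+1) p q : q \in neighbors G p ->
    has (joins p q) (edges G) by case/neighborsP.
case: c lc => [p h|p x z] lc.
  exists (N :\ p), (fun a => if a == h
    then VHad (V h) (VMul (mexpr_bundle E h p) (V p)) else V a),
    [seq x : T * T * mexpr <- E | (x.1.1 != p) && (x.1.2 != p)] => n A hA.
  have [_ _ _ Np] := hinge_neighbor (lc n A hA).
  have [nF vF eF] := hF n A hA; split=> /=; [by rewrite nF| |exact: edges_without_map].
  move=> a; case: eqP => // _ /=; rewrite !vF (meval_bundle hA (hF n A hA)) //.
  have /joined : h \in neighbors (F n A) p by rewrite Np set11.
  by apply: sub_has => e; rewrite /joins orbC.
exists (N :\ p), V, (rcons [seq x : T * T * mexpr <- E | (x.1.1 != p) && (x.1.2 != p)]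
  (x, z, MMul (MMul (mexpr_tr (mexpr_bundle E p x)) (MDiag (V p)))
    (mexpr_bundle E p z))) => n A hA.
have [_ _ _ _ Np] := hinge_neighbor (lc n A hA).
have [nF vF eF] := hF n A hA; split=> //=; first by rewrite nF.
rewrite (edges_without_map _ eF) map_rcons /= meval_tr; last by case: hA.
by rewrite !(meval_bundle hA (hF n A hA)) ?vF //; apply: joined; rewrite Np ?set21 ?set22.
Qed.

Lemma expressible_prune_all F n0 (A0 : 'M[R]_n0.+1) s : sym_hollow A0 ->
  expressible F -> complete_run (F n0 A0) s ->
  expressible (fun n A => prune_all (F n A) s).
Proof.
move=> hA0; elim: s F => [|c s IH] F eF //= /and3P[_ lc run].
exact: (IH (fun n A => prune (F n A) c)) (expressible_prune hA0 eF lc) run.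
Qed.

Lemma SEA_term_expressible F p : expressible F ->
  SEA_term (fun n A => ones_dot (vlab (F n A) p)).
Proof.
by move=> [N [V [E hF]]]; exists (V p) => n A hA; have [_ -> _] := hF n A hA.
Qed.

Lemma sum_pffun_enum_rank n N a0 (a0N : a0 \in N) (f : {ffun T -> 'I_n.+1} -> R) :
  \sum_(j in pffun_on ord0 N predT) f j =
  \sum_(g : {ffun 'I_#|N| -> 'I_n.+1})
    f [ffun a => if a \in N then g (enum_rank_in a0N a) else ord0].
Proof.
rewrite (@big_reindex_bij _ _ {ffun 'I_#|N| -> 'I_n.+1} _ predT
  (fun g => [ffun a => if a \in N then g (enum_rank_in a0N a) else ord0])
  (fun j => [ffun k => j (enum_val k)])) //.
  move=> j /mem_pffun_ord0 hj; split=> //; apply/ffunP => a; rewrite !ffunE.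
  by case: ifPn => [aN|/hj//]; rewrite enum_rankK_in.
move=> g _; split; first by apply/mem_pffun_ord0 => a /negbTE aN; rewrite ffunE aN.
by apply/ffunP => k; rewrite !ffunE enum_valP enum_valK_in.
Qed.

(** A node label [v] enters as the factor [diag(v)] with the index of the node repeated, an edge
    label as a factor on two different indices. *)
Lemma layer_FS_term_expressible F n0 (A0 : 'M[R]_n0.+1) : sym_hollow A0 ->
  expressible F -> well_formed (F n0 A0) -> nodes (F n0 A0) != set0 ->
  layer_FS_term #|nodes (F n0 A0)| (fun n A => full_sum (F n A)).
Proof.
move=> hA0 [N [V [E hF]]] wf; have [nF0 _ eF0] := hF n0 A0 hA0.
rewrite nF0 => /set0Pn[a0 a0N].
have wfE : all (fun x : T * T * mexpr =>
    [&& x.1.1 \in N, x.1.2 \in N & x.1.1 != x.1.2]) E.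
  by move: wf; rewrite /well_formed eF0 nF0 all_map.
pose r := enum_rank_in a0N.
pose L : seq ('I_#|N| * 'I_#|N| * mexpr) :=
  [seq (r a, r a, MDiag (V a)) | a <- enum N] ++
  [seq (r x.1.1, r x.1.2, x.2) | x <- E].
pose t := in_tuple L.
exists (size L), (fun i => (tnth t i).1.1), (fun i => (tnth t i).1.2),
  (fun i => (tnth t i).2); split.
- by rewrite size_cat size_map -cardE ltn_addr // card_gt0; apply/set0Pn; exists a0.
(* Diagonality is checked on the syntax: a factor with a repeated index must come from a node,
   because edges have distinct ends and [r] is injective on [N]. *)
- move=> i; pose isdiag (x : 'I_#|N| * 'I_#|N| * mexpr) :=
    (x.1.1 == x.1.2) ==> (if x.2 is MDiag _ then true else false).
  have /all_tnthP/(_ i) : all isdiag t.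
    rewrite all_cat !all_map /isdiag; apply/andP; split.
      by apply/allP => a _ /=; rewrite implybT.
    apply: sub_all wfE => x /and3P[x1 x2 x12] /=; apply/implyP => /eqP rx.
    by move: x12; rewrite -(enum_rankK_in a0N x1) -(enum_rankK_in a0N x2) -/r rx eqxx.
  rewrite /isdiag => /implyP h /eqP /h; case: (tnth t i).2 => // v _ n A _.
  exact: diag_mx_is_diag.
move=> n A hA; have [nF vF eF] := hF n A hA.
rewrite /full_sum nF eF (sum_pffun_enum_rank a0N); apply: eq_bigr => g _.
have -> : \prod_(i < size L) meval A (tnth t i).2 (g (tnth t i).1.1) (g (tnth t i).1.2)
   = \prod_(x <- L) meval A x.2 (g x.1.1) (g x.1.2) by rewrite big_tnth.
rewrite big_cat !big_map big_enum /=; congr (_ * _).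
  by apply: eq_bigr => a aN; rewrite ffunE aN vF !mxE eqxx.
elim: E wfE {hF eF0 eF L t} => [|x E IH]; first by rewrite !big_nil.
by move=> /= /andP[/and3P[x1 x2 _] /IH]; rewrite !big_cons !ffunE x1 x2 => ->.
Qed.

End SymbolicLabels.

(** * Lists of undirected edges up to reordering and reversal *)

Section MultiplicityLists.
Variable U : finType.
Implicit Types (L : seq (U * U)) (a b c d : U) (e : U * U).

Definition pair_multiplicity L a b : nat :=
  count (fun e => (e == (a, b)) || (e == (b, a))) L.

(** A normal form of unordered pairs; [U] carries no order of its own, so its enumeration supplies
    one. *)
Definition sort_pair e : U * U :=
  if (enum_rank e.1 <= enum_rank e.2)%N then e else (e.2, e.1).

Lemma count_sort_pair L c d :
  count_mem (c, d) (map sort_pair L) =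
    if (enum_rank c <= enum_rank d)%N then pair_multiplicity L c d else 0%N.
Proof.
have sortE e : (sort_pair e == (c, d)) =
    (enum_rank c <= enum_rank d)%N && ((e == (c, d)) || (e == (d, c))).
  case: e => a b; rewrite /sort_pair /=; case: leqP => ab.
    apply/eqP/andP => [[<- <-]|[cd /orP[/eqP//|/eqP[ad bc]]]].
      by rewrite ab eqxx.
    rewrite -ad -bc in cd *; congr (_, _); apply/enum_rank_inj/val_inj/eqP;
    by rewrite eqn_leq ab cd.
  apply/eqP/andP => [[<- <-]|[cd /orP[/eqP[ac bd]|/eqP[-> ->]//]]].
    by rewrite ltnW // eqxx orbT.
  by move: ab; rewrite ac bd ltnNge cd.
rewrite count_map (eq_count (a2 := fun e => (enum_rank c <= enum_rank d)%N &&
  ((e == (c, d)) || (e == (d, c))))); last by move=> e; rewrite /= sortE.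
by case: ifP => _ //; rewrite count_pred0.
Qed.

(** Once every pair is sorted, the multiplicities determine the list up to permutation. *)
Lemma prod_eq_multiplicity (R : comNzRingType) (g : U * U -> R) L1 L2 :
  (forall a b, g (a, b) = g (b, a)) ->
  (forall a b, pair_multiplicity L1 a b = pair_multiplicity L2 a b) ->
  \prod_(e <- L1) g e = \prod_(e <- L2) g e.
Proof.
move=> gC mE; have sortE L : \prod_(e <- L) g e = \prod_(e <- map sort_pair L) g e.
  rewrite big_map; apply: eq_bigr => [[a b]] _.
  by rewrite /sort_pair; case: ifP.
rewrite sortE [RHS]sortE; apply: perm_big; apply/allP => [[c d]] _.
by rewrite /= !count_sort_pair mE.
Qed.

Lemma pair_multiplicity_map (f : U -> U) L a b : injective f ->
  pair_multiplicity [seq (f e.1, f e.2) | e <- L] (f a) (f b) =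
    pair_multiplicity L a b.
Proof.
move=> fI; rewrite /pair_multiplicity count_map; apply: eq_count => [[c d]] /=.
by rewrite !xpair_eqE !(inj_eq fI).
Qed.

(** Each edge at [a] is counted at its other end. A self-loop at [a] would count once on the left
    and twice on the right. *)
Lemma sum_pair_multiplicity L a : all (fun e => e.1 != e.2) L ->
  (\sum_b pair_multiplicity L a b =
    count (fun e => e.1 == a) L + count (fun e => e.2 == a) L)%N.
Proof.
rewrite /pair_multiplicity; elim: L => [|[c d] L IH] /=; first by rewrite big1.
case/andP => cd /IH {}IH; rewrite big_split /= IH addnACA; congr (_ + _)%N.
under eq_bigr do rewrite !xpair_eqE.
have [ca|ca] /= := eqVneq c a.
  rewrite ca in cd *; rewrite [d == a]eq_sym (negbTE cd) (bigD1 d) //= eqxx.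
  rewrite big1 ?addn0 // => b bd.
  by rewrite [d == b]eq_sym (negbTE bd) andbF.
have [da|da] := eqVneq d a; last by rewrite big1 // => b _; rewrite andbF.
rewrite (bigD1 c) //= eqxx big1 ?addn0 // => b bc.
by rewrite eq_sym (negbTE bc).
Qed.

End MultiplicityLists.

(** * Induced FAMs: isomorphism, Full Sum, orientation, connectedness *)

Section InducedFams.
Variable m : nat.
Implicit Types (P Q : {set {set 'I_m}}) (a b : {set 'I_m}) (r : 'I_m).

Lemma multiplicityE P a b : multiplicity P a b = pair_multiplicity (block_edges P) a b.
Proof. by []. Qed.

Lemma pblock_setT P r : partition P setT -> pblock P r \in P.
Proof. by move=> pP; rewrite pblock_mem // (cover_partition pP). Qed.

Lemma mem_pblock_setT P r : partition P setT -> r \in pblock P r.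
Proof. by move=> pP; rewrite mem_pblock (cover_partition pP). Qed.

Lemma pblock_eq P a r : partition P setT -> a \in P -> (pblock P r == a) = (r \in a).
Proof.
move=> pP aP; apply/eqP/idP => [<-|]; first exact: mem_pblock_setT.
exact: def_pblock (partition_trivIset pP) aP.
Qed.

Lemma pair_multiplicity_out P a b : partition P setT -> ~~ ((a \in P) && (b \in P)) ->
  pair_multiplicity (block_edges P) a b = 0%N.
Proof.
move=> pP ab; apply/eqP; rewrite -leqn0 leqNgt -has_count; apply: contra ab.
case/hasP => _ /mapP[r _ ->] /orP[] /eqP[<- <-]; by rewrite !pblock_setT.
Qed.

(** An isomorphism only controls the nodes, but multiplicities involving a set that is not a block
    vanish on both sides, so whole edge lists can be compared. *)
Lemma iso_induced_multiplicity P Q (f : {perm {set 'I_m}}) :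
  partition P setT -> partition Q setT -> f @: P = Q ->
  {in P &, forall a b, multiplicity Q (f a) (f b) = multiplicity P a b} ->
  forall a b, pair_multiplicity [seq (f e.1, f e.2) | e <- block_edges P] a b =
    pair_multiplicity (block_edges Q) a b.
Proof.
move=> pP pQ fP fm c d; rewrite -(permKV f c) -(permKV f d).
move: (_ c) (_ d) => a b; rewrite pair_multiplicity_map; last exact: perm_inj.
have [/andP[aP bP]|ab] := boolP ((a \in P) && (b \in P)).
  by rewrite -!multiplicityE fm.
rewrite !pair_multiplicity_out // -fP !(mem_imset _ _ (@perm_inj _ f)) //.
Qed.

(** Edges leaving [a] correspond to its symbols and edges entering it to the cyclic predecessors of
    these symbols, equally many since [ordS] is injective. *)
Lemma sum_multiplicity P a : partition P setT -> self_loop_free P -> a \in P ->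
  (\sum_b multiplicity P a b = #|a|.*2)%N.
Proof.
move=> pP slf aP; rewrite sum_pair_multiplicity // !count_map -addnn.
rewrite (eq_count (a2 := fun r => r \in a)) => [|r]; last by rewrite /= pblock_eq.
rewrite [X in (_ + X)%N](eq_count (a2 := fun r => r \in @ordS m @^-1: a)) => [|r]; last first.
  by rewrite /= pblock_eq // inE.
have cE (S : {set 'I_m}) : count (fun r => r \in S) (enum 'I_m) = #|S|.
  by rewrite -sum1_count big_enum_cond /= sum1_card.
by rewrite -enumT !cE card_preimset //; apply: ordS_inj.
Qed.

Lemma iso_inducedP P Q :
  reflect (exists2 f : {perm {set 'I_m}}, f @: P = Q &
      {in P &, forall a b, multiplicity Q (f a) (f b) = multiplicity P a b})
    (iso_induced P Q).
Proof.
apply: (iffP existsP) => [[f /andP[/eqP fP h]]|[f fP h]]; exists f => //.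
  move=> a b aP bP; apply/eqP.
  by move/forall_inP/(_ a aP)/forall_inP/(_ b bP): h.
rewrite fP eqxx; apply/forall_inP => a aP; apply/forall_inP => b bP.
by apply/eqP/h.
Qed.

Lemma iso_induced_refl P : iso_induced P P.
Proof.
apply/iso_inducedP; exists 1%g => [|a b _ _]; last by rewrite !perm1.
by rewrite -[RHS]imset_id; apply: eq_imset => a; rewrite perm1.
Qed.

Lemma iso_induced_sym P Q : iso_induced P Q -> iso_induced Q P.
Proof.
case/iso_inducedP => f fP h; apply/iso_inducedP; exists (f^-1)%g.
  rewrite -fP -imset_comp -[RHS]imset_id; apply: eq_imset => a.
  by rewrite /= permK.
by move=> a b; rewrite -fP => /imsetP[a' aP ->] /imsetP[b' bP ->]; rewrite !permK fP h.
Qed.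

Lemma iso_induced_trans P Q S :
  iso_induced P Q -> iso_induced Q S -> iso_induced P S.
Proof.
case/iso_inducedP => f fP hf /iso_inducedP[g gQ hg].
apply/iso_inducedP; exists (f * g)%g.
  by rewrite -gQ -fP -imset_comp; apply: eq_imset => a; rewrite permM.
move=> a b aP bP; rewrite !permM hg ?hf // -fP; exact: imset_f.
Qed.

Lemma iso_induced_equivalence k :
  {in inducing m k & &, equivalence_rel (@iso_induced m)}.
Proof.
move=> P Q S _ _ _; split; first exact: iso_induced_refl.
move=> PQ; apply/idP/idP; last exact: iso_induced_trans.
by apply: iso_induced_trans; apply: iso_induced_sym.
Qed.

Lemma iso_class_partition k : partition (iso_classes m k) (inducing m k).
Proof. exact: equivalence_partitionP (@iso_induced_equivalence k). Qed.

Lemma iso_class_inducing k (t : 'I_(num_classes m k)) P :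
  P \in iso_class t -> P \in inducing m k.
Proof.
by move=> Pt; apply: (subsetP (partitionS (iso_class_partition k) (enum_valP t))).
Qed.

Lemma iso_class_iso k (t : 'I_(num_classes m k)) P Q :
  P \in iso_class t -> Q \in iso_class t -> iso_induced P Q.
Proof.
move=> Pt Qt; have := pblock_equivalence_partition (@iso_induced_equivalence k).
move=> /(_ P Q (iso_class_inducing Pt) (iso_class_inducing Qt)) <-.
rewrite -/(iso_classes m k).
by rewrite (def_pblock (partition_trivIset (iso_class_partition k)) (enum_valP t) Pt).
Qed.

Lemma iso_induced_block_size P Q : partition P setT -> partition Q setT ->
  self_loop_free P -> self_loop_free Q ->
  forall f : {perm {set 'I_m}}, f @: P = Q ->
  {in P &, forall a b, multiplicity Q (f a) (f b) = multiplicity P a b} ->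
  {in P, forall a, #|f a| = #|a|}.
Proof.
move=> pP pQ sP sQ f fP h a aP; apply: double_inj.
have faQ : f a \in Q by rewrite -fP imset_f.
rewrite -(sum_multiplicity pP sP aP) -(sum_multiplicity pQ sQ faQ).
rewrite (reindex_inj (@perm_inj _ f)) /=; apply: eq_bigr => b _.
rewrite !multiplicityE -(iso_induced_multiplicity pP pQ fP h).
by rewrite pair_multiplicity_map //; apply: perm_inj.
Qed.

Section Labelled.
Variables (R : comNzRingType) (n : nat) (A : 'M[R]_n.+1).

Lemma full_sum_induced_blocks P :
  full_sum (induced_fam A P) =
  \sum_(j in pffun_on (ord0 : 'I_n.+1) P predT)
    \prod_(e <- block_edges P) A (j e.1) (j e.2).
Proof.
apply: eq_bigr => j _ /=; rewrite big_map big1 ?mul1r // => a _.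
by rewrite mxE.
Qed.

(** One index per block amounts to a map on the symbols that is constant on blocks. For the
    converse, [ext] reads the index of a block at any of its symbols. *)
Lemma full_sum_induced P : partition P setT ->
  full_sum (induced_fam A P) =
  \sum_(i : {ffun 'I_m -> 'I_n.+1} | constant_on_blocks i P)
    \prod_(r < m) A (i r) (i (ordS r)).
Proof.
move=> pP; rewrite full_sum_induced_blocks.
pose ext (i : {ffun 'I_m -> 'I_n.+1}) := [ffun a : {set 'I_m} =>
  if a \in P then (if [pick r in a] is Some r then i r else ord0) else ord0].
have extE (i : {ffun 'I_m -> 'I_n.+1}) r : constant_on_blocks i P -> ext i (pblock P r) = i r.
  move=> /forall_inP h; rewrite ffunE pblock_setT //.
  case: pickP => [q qr|/(_ r)]; last by rewrite mem_pblock_setT.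
  by apply: (constant_onP _ _ (h _ (pblock_setT r pP))) => //; apply: mem_pblock_setT.
rewrite (@big_reindex_bij _ _ _ _
  (fun i : {ffun 'I_m -> 'I_n.+1} => constant_on_blocks i P) ext
  (fun j => [ffun r => j (pblock P r)])).
- apply: eq_bigr => i hi; rewrite big_map big_enum /=.
  by apply: eq_bigr => r _; rewrite !extE.
- move=> j /mem_pffun_ord0 hj; split.
    apply/forall_inP => a aP; apply/constant_onP => r q ra qa; rewrite !ffunE.
    by move: ra qa; rewrite -!(pblock_eq _ pP aP) => /eqP-> /eqP->.
  apply/ffunP => a; rewrite ffunE; case: ifPn => [aP|/hj->//].
  case: pickP => [q|a0].
    by rewrite -(pblock_eq _ pP aP) ffunE => /eqP->.
  have := partition_neq0 pP aP; suff -> : a = set0 by rewrite eqxx.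
  by apply/setP => r; rewrite inE -(a0 r).
- move=> i hi; split; last by apply/ffunP => r; rewrite ffunE extE.
  by apply/mem_pffun_ord0 => a /negbTE aP; rewrite ffunE aP.
Qed.

(** Relabeling the assignments by [f] matches the products only up to the direction of edges;
    symmetry of [A] absorbs the rest. *)
Lemma full_sum_iso P Q : A^T = A -> partition P setT -> partition Q setT ->
  iso_induced P Q -> full_sum (induced_fam A P) = full_sum (induced_fam A Q).
Proof.
move=> As pP pQ /iso_inducedP[f fP h]; rewrite !full_sum_induced_blocks.
have memQ a : (f a \in Q) = (a \in P) by rewrite -fP mem_imset //; apply: perm_inj.
rewrite (@big_reindex_bij _ _ _ _
  (fun j : {ffun {set 'I_m} -> 'I_n.+1} => j \in pffun_on ord0 Q predT)
  (fun j => [ffun a => j (f a)]) (fun j => [ffun a => j ((f^-1)%g a)])).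
- apply: eq_bigr => j _.
  rewrite -[RHS](@prod_eq_multiplicity _ _ _ [seq (f e.1, f e.2) | e <- block_edges P]).
  + by rewrite big_map; apply: eq_bigr => e _; rewrite !ffunE.
  + by move=> a b /=; rewrite -[in LHS]As mxE.
  + exact: iso_induced_multiplicity.
- move=> j /mem_pffun_ord0 hj; split; last by apply/ffunP => a; rewrite !ffunE permK.
  apply/mem_pffun_ord0 => a aQ; rewrite ffunE hj //.
  by rewrite -memQ permKV.
- move=> j /mem_pffun_ord0 hj; split; last by apply/ffunP => a; rewrite !ffunE permKV.
  by apply/mem_pffun_ord0 => a aP; rewrite ffunE hj // memQ.
Qed.

Lemma full_sum_self_loop P : (forall x, A x x = 0) -> partition P setT ->
  ~~ self_loop_free P -> full_sum (induced_fam A P) = 0.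
Proof.
move=> A0 pP; rewrite full_sum_induced_blocks => /allPn[e eP /negPn/eqP e12].
by apply: big1 => j _; rewrite (big_rem e eP) /= e12 A0 mul0r.
Qed.

(** [zip] truncates to the shorter list, hence the size hypothesis. Every property blind to
    directions is transferred through this statement. *)
Lemma orient_map (T : finType) U (o : bitseq) (G : fam R T n.+1)
    (f : T * T * 'M[R]_n.+1 -> U) :
  size o = size (edges G) ->
  (forall e, e \in edges G -> f (e.1.2, e.1.1, e.2) = f e) ->
  map f (edges (orient o G)) = map f (edges G).
Proof.
rewrite /orient /=; elim: (edges G) o => [|e E IH] [|b o] //= [so] h.
rewrite IH //; last by move=> e' eE; apply: h; rewrite inE eE orbT.
by case: b => //; rewrite h // inE eqxx.
Qed.

Lemma orient_has (T : finType) (o : bitseq) (G : fam R T n.+1)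
    (p : pred (T * T * 'M[R]_n.+1)) :
  size o = size (edges G) -> (forall e, p (e.1.2, e.1.1, e.2) = p e) ->
  has p (edges (orient o G)) = has p (edges G).
Proof.
move=> so pE; have hid E : has p E = has id (map p E) by rewrite has_map.
by rewrite hid (hid (edges G)) orient_map.
Qed.

Lemma orient_all (T : finType) (o : bitseq) (G : fam R T n.+1)
    (p : pred (T * T * 'M[R]_n.+1)) :
  size o = size (edges G) -> (forall e, p (e.1.2, e.1.1, e.2) = p e) ->
  all p (edges (orient o G)) = all p (edges G).
Proof.
move=> so pE; have hid E : all p E = all id (map p E) by rewrite all_map.
by rewrite hid (hid (edges G)) orient_map.
Qed.

Lemma neighbors_orient (T : finType) (o : bitseq) (G : fam R T n.+1) (a : T) :
  size o = size (edges G) -> neighbors (orient o G) a = neighbors G a.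
Proof.
move=> so; apply/setP => b; rewrite !inE; congr (_ && (_ && _)).
rewrite orient_has // => [[[c d] M]] /=.
by rewrite !xpair_eqE orbC; congr (_ || _); rewrite andbC.
Qed.

Lemma size_induced_edges P : size (edges (induced_fam A P)) = m.
Proof. by rewrite !size_map -enumT size_enum_ord. Qed.

Variable o : m.-tuple bool.

Lemma full_sum_orient P : A^T = A ->
  full_sum (orient o (induced_fam A P)) = full_sum (induced_fam A P).
Proof.
move=> As; apply: eq_bigr => j _; congr (_ * _).
rewrite -[LHS](big_map (edge_weight j) xpredT id) orient_map ?big_map //.
  by rewrite size_tuple size_induced_edges.
by move=> e /mapP[k _ ->]; rewrite /edge_weight /= -[in LHS]As mxE.
Qed.

Lemma well_formed_induced P : partition P setT -> self_loop_free P ->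
  well_formed (orient o (induced_fam A P)).
Proof.
move=> pP slf; rewrite /well_formed orient_all; first last.
- by move=> e /=; rewrite andbCA [e.1.2 == _]eq_sym.
- by rewrite size_tuple size_induced_edges.
rewrite /= all_map; apply/allP => e eP /=; rewrite (allP slf e eP) andbT.
by case/mapP: eP => r _ -> /=; rewrite !pblock_setT.
Qed.

Lemma iter_ordS (X : pred 'I_m) r : (forall q, X q -> X (ordS q)) -> X r ->
  forall q, X q.
Proof.
move=> XS Xr q; have mgt0 : (0 < m)%N by apply: leq_ltn_trans (ltn_ord r).
(* From [r], the first [m - r] steps complete the turn to 0 and [q] more steps reach [q]. *)
suff -> : q = iter (q + (m - r))%N (@ordS m) r by elim: (_ + _)%N => //= c; apply: XS.
have iterE c : iter c (@ordS m) r = ((r + c) %% m)%N :> nat.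
  elim: c => [|c IH]; first by rewrite addn0 modn_small.
  by rewrite iterS [LHS]/= IH -addn1 modnDml addn1 addnS.
apply: val_inj; rewrite /= iterE addnCA subnKC; last exact: ltnW.
by rewrite modnDr modn_small.
Qed.

(** If no edge crosses the cut, going round the cycle never leaves [X], and the cycle visits every
    block. *)
Lemma cut_connected_induced P : partition P setT ->
  cut_connected (orient o (induced_fam A P)).
Proof.
move=> pP X XP /set0Pn[a aX] XnP; rewrite orient_has; first last.
- by move=> e /=; rewrite eq_sym.
- by rewrite size_tuple size_induced_edges.
rewrite /= has_map; apply/negPn/negP => noX.
have XS q : pblock P q \in X -> pblock P (ordS q) \in X.
  move=> qX; apply: contraNT noX => qSX; apply/hasP.
  exists (pblock P q, pblock P (ordS q)); last by rewrite /= qX (negbTE qSX).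
  by apply: map_f; rewrite mem_enum.
have aP := subsetP XP a aX.
have /set0Pn[r ra] := partition_neq0 pP aP.
have rX : pblock P r \in X by rewrite (def_pblock (partition_trivIset pP) aP ra).
have allX := @iter_ordS (fun q => pblock P q \in X) r XS rX.
case/negP: XnP; rewrite eqEsubset XP; apply/subsetP => b bP.
have /set0Pn[q qb] := partition_neq0 pP bP.
by rewrite -(def_pblock (partition_trivIset pP) bP qb); apply: allX.
Qed.

(** Only two cycle edges meet the symbol [r], so the neighbors are among the blocks of its successor
    and predecessor. *)
Lemma card_neighbors_singleton P r : partition P setT -> [set r] \in P ->
  (#|neighbors (orient o (induced_fam A P)) [set r]| <= 2)%N.
Proof.
move=> pP rP; rewrite neighbors_orient; last by rewrite size_induced_edges size_tuple.
apply: leq_trans (_ : #|[set pblock P (ordS r); pblock P (ord_pred r)]| <= _)%N;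
  last by rewrite cards2; case: (_ != _).
apply/subset_leq_card/subsetP => b /neighborsP[_ _].
case/hasP => _ /mapP[e /mapP[q _ ->] ->]; rewrite /joins /= !inE.
case/orP => /eqP[].
  by move/eqP; rewrite pblock_eq // inE => /eqP-> <-; rewrite eqxx.
move=> <- /eqP; rewrite pblock_eq // inE => /eqP <-.
by rewrite ordSK eqxx orbT.
Qed.

End Labelled.

Lemma expressible_induced (R : comNzRingType) P (o : bitseq) :
  expressible (fun n (A : 'M[R]_n.+1) => orient o (induced_fam A P)).
Proof.
exists P, (fun _ => VOne), [seq ((if be.1 then (be.2.2, be.2.1) else be.2), MA)
   | be <- zip o (block_edges P)] => n A _; split=> //=.
elim: o (block_edges P) => [|b o IH] [|e E] //=; rewrite IH.
by case: b.
Qed.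

End InducedFams.

(** * Expansion of the cycle count over isomorphism classes *)

Section CycleCountExpansion.
Variables (R : comNzRingType) (m n : nat) (A : 'M[R]_n.+1).
Implicit Types (P Q : {set {set 'I_m}}).

(** The indicator of injectivity is expanded over partitions and the sums are exchanged; the
    constancy constraint then turns the sum over [i] into a Full Sum. *)
Lemma cycle_count_partitions :
  cycle_count m A = \sum_(P : {set {set 'I_m}} | partition P setT)
    (\prod_(B in P) block_weight R B) * full_sum (induced_fam A P).
Proof.
rewrite /cycle_count big_mkcond /=.
transitivity (\sum_(i : {ffun 'I_m -> 'I_n.+1})
    \sum_(P : {set {set 'I_m}} | partition P setT && constant_on_blocks i P)
      (\prod_(B in P) block_weight R B) * \prod_(r < m) A (i r) (i (ordS r))).
  apply: eq_bigr => i _; rewrite -mulr_suml sum_partitions_injective.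
  have -> : dinjectiveb i [set: 'I_m] = injectiveb i.
    apply/dinjectiveP/injectiveP => inj a b; last by move=> _ _; apply: inj.
    by apply: inj; rewrite inE.
  by case: ifP; rewrite ?mul1r ?mul0r.
rewrite (exchange_big_dep (fun P => partition P setT)) /=; last by move=> i P _ /andP[].
apply: eq_bigr => P pP; rewrite full_sum_induced // mulr_sumr.
by apply: eq_bigl => i; rewrite pP.
Qed.

(** The exponents of the signs add up to the sum of [#|B| - 1] over the blocks, which is
    [m - #|P|]. *)
Lemma prod_block_weight P : partition P setT ->
  \prod_(B in P) block_weight R B =
    (-1) ^+ (m - #|P|) * \prod_(B in P) (#|B|.-1)`!%:R.
Proof.
move=> pP; rewrite big_split /= prodrXr; congr (_ ^+ _ * _).
have mE : m = (\sum_(B in P) #|B|.-1 + #|P|)%N.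
  rewrite -[LHS]card_ord -cardsT (card_partition pP) -sum1_card -big_split /=.
  apply: eq_bigr => B BP; rewrite addn1 prednK // card_gt0.
  exact: partition_neq0 pP BP.
by apply/esym/(etrans (congr1 (subn^~ #|P|) mE))/addnK.
Qed.

Lemma inducing_partition k P : P \in inducing m k ->
  [/\ partition P setT, #|P| = k & self_loop_free P].
Proof. by rewrite inE => /and3P[? /eqP]. Qed.

(** This is the range of [k]: without self-loops the first cycle edge already joins two different
    blocks, and at most [m] non-empty disjoint blocks fit. *)
Lemma self_loop_free_card P : (0 < m)%N -> partition P setT -> self_loop_free P ->
  (2 <= #|P| <= m)%N.
Proof.
move=> m0 pP slf; apply/andP; split.
  have /(allP slf) /= ne : (pblock P (Ordinal m0), pblock P (ordS (Ordinal m0)))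
      \in block_edges P by apply: map_f; rewrite mem_enum.
  rewrite (cardsD1 (pblock P (Ordinal m0))) pblock_setT // ltnS card_gt0.
  apply/set0Pn; exists (pblock P (ordS (Ordinal m0))).
  by rewrite !inE eq_sym ne pblock_setT.
rewrite -[leqRHS]card_ord -cardsT (card_partition pP) -sum1_card.
apply: leq_sum => B BP; rewrite card_gt0.
exact: partition_neq0 pP BP.
Qed.

Lemma class_invariant k (t : 'I_(num_classes m k)) P Q : A^T = A ->
  P \in iso_class t -> Q \in iso_class t ->
  (\prod_(B in P) block_weight R B) * full_sum (induced_fam A P) =
  (\prod_(B in Q) block_weight R B) * full_sum (induced_fam A Q).
Proof.
move=> As Pt Qt; have iPQ := iso_class_iso Pt Qt.
have [pP _ sP] := inducing_partition (iso_class_inducing Pt).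
have [pQ _ sQ] := inducing_partition (iso_class_inducing Qt).
congr (_ * _); last exact: full_sum_iso.
case/iso_inducedP: iPQ => f fP h.
rewrite -fP big_imset /=; last by move=> a b _ _; apply: perm_inj.
apply: eq_bigr => B BP.
by rewrite /block_weight (iso_induced_block_size pP pQ sP sQ fP h BP).
Qed.

Lemma cycle_count_classes
    (sigma : forall k : nat, 'I_(num_classes m k) -> {set {set 'I_m}}) :
  (0 < m)%N -> sym_hollow A ->
  (forall (k : nat) (t : 'I_(num_classes m k)), (2 <= k <= m)%N ->
     sigma k t \in iso_class t) ->
  cycle_count m A =
    \sum_(2 <= k < m.+1) \sum_(t < num_classes m k)
      coefficient R t (sigma k t) * full_sum (induced_fam A (sigma k t)).
Proof.
move=> m0 [As A0] hsigma; rewrite cycle_count_partitions.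
rewrite (bigID (@self_loop_free m)) /= [X in _ + X]big1 ?addr0; last first.
  by move=> P /andP[pP /(full_sum_self_loop A0 pP)->]; rewrite mulr0.
pose F (P : {set {set 'I_m}}) :=
  (\prod_(B in P) block_weight R B) * full_sum (induced_fam A P).
transitivity (\sum_(2 <= k < m.+1) \sum_(P in inducing m k) F P).
  rewrite [RHS](exchange_big_dep (fun P : {set {set 'I_m}} =>
    partition P setT && self_loop_free P)) /=; last first.
    by move=> k P _ /inducing_partition[-> _ ->].
  apply: eq_bigr => P /andP[pP slf].
  have cP := self_loop_free_card m0 pP slf.
  rewrite (eq_bigl (fun k => k == #|P|)) => [|k]; last by rewrite inE pP slf andbT eq_sym.
  by rewrite big_nat1_eq ltnS cP.
apply: eq_big_nat => k hk; rewrite ltnS in hk.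
rewrite (set_partition_big _ (iso_class_partition m k)) /= big_enum_val.
apply: eq_bigr => t _; have st := hsigma k t hk.
have [pS cS _] := inducing_partition (iso_class_inducing st).
rewrite (eq_bigr (fun _ => F (sigma k t))) => [|P Pt]; last first.
  exact: class_invariant Pt st.
(* The constant summand is repeated once per member of the class, which yields the cardinality
   factor in [coefficient]. *)
rewrite sumr_const -mulr_natl /F prod_block_weight // cS /coefficient.
by rewrite !mulrA.
Qed.

End CycleCountExpansion.

(** The blocks in [N] are disjoint sets of symbols, so their sizes add up to at most [m]. *)
Lemma sum_card_ge2 m (P N : {set {set 'I_m}}) : partition P setT -> N \subset P ->
  (forall B, B \in N -> (2 <= #|B|)%N) -> (#|N| <= m./2)%N.
Proof.
move=> pP NP h2; rewrite geq_half_double -muln2 -sum_nat_const.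
rewrite -[leqRHS]card_ord -cardsT (card_partition pP).
rewrite [leqRHS](big_setID N) /= (setIidPr NP); apply: leq_trans (leq_addr _ _).
exact: leq_sum.
Qed.

Theorem theorem4 (R : realType) (m n : nat) (hm : (3 <= m)%N)
  (A : 'M[R]_n.+1) (hA : sym_hollow A)
  (sigma : forall k : nat, 'I_(num_classes m k) -> {set {set 'I_m}})
  (hsigma : forall (k : nat) (t : 'I_(num_classes m k)), (2 <= k <= m)%N ->
     sigma k t \in iso_class t)
  (o : forall k : nat, 'I_(num_classes m k) -> m.-tuple bool)
  (s : forall k : nat, 'I_(num_classes m k) -> seq (pruning_choice {set 'I_m}))
  (hs : forall (k : nat) (t : 'I_(num_classes m k)), (2 <= k <= m)%N ->
     complete_run (orient (o k t) (induced_fam A (sigma k t))) (s k t)) :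
  cycle_count m A =
    \sum_(2 <= k < m.+1) \sum_(t < num_classes m k)
      coefficient R t (sigma k t) *
      full_sum (final_fam A (sigma k t) (o k t) (s k t))
  /\
  forall (k : nat) (t : 'I_(num_classes m k)), (2 <= k <= m)%N ->
    let final n' (A' : 'M[R]_n'.+1) :=
      final_fam A' (sigma k t) (o k t) (s k t) in
    let G := final n A in
    (exists p,
       [/\ nodes G = [set p],
           full_sum G = ones_dot (vlab G p)
         & SEA_term (fun n' A' => ones_dot (vlab (final n' A') p))])
    \/
    ([/\ (1 < #|nodes G|)%N,
         forall p, ~~ pendant G p,
         (4 <= #|nodes G|)%N
       & forall a, a \in nodes G -> (3 <= #|neighbors G a|)%N]
     /\
     [/\ layer_FS_term #|nodes G| (fun n' A' => full_sum (final n' A'))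
       & (4 <= #|nodes G| <= m./2)%N]).
Proof.
have m0 : (0 < m)%N by apply: leq_trans hm.
have As : A^T = A by case: hA.
have final_inv k (t : 'I_(num_classes m k)) : (2 <= k <= m)%N ->
    pruning_invariant (orient (o k t) (induced_fam A (sigma k t)))
      (final_fam A (sigma k t) (o k t) (s k t)) /\
    ~~ can_continue (final_fam A (sigma k t) (o k t) (s k t)).
  move=> hk; have [pS cS sS] := inducing_partition (iso_class_inducing (hsigma k t hk)).
  apply: complete_run_invariant (hs k t hk).
  - exact: well_formed_induced.
  - exact: cut_connected_induced.
  - by rewrite /= -card_gt0 cS; case/andP: hk => /ltnW.
split.
  rewrite (cycle_count_classes m0 hA hsigma).
  apply: eq_big_nat => k hk; apply: eq_bigr => t _; congr (_ * _).
  by have [[_ _ -> _ _] _] := final_inv k t hk; rewrite full_sum_orient.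
move=> k t hk final G.
have [pS _ _] := inducing_partition (iso_class_inducing (hsigma k t hk)).
have [[wf cc _ G0 [Gsub nbG]] stop] := final_inv k t hk.
(* The run [hs] is for [A] alone, yet the resulting expressions hold for all [n'] and [A'], as both
   kinds of terms demand. *)
have ex : expressible final.
  exact: expressible_prune_all hA (expressible_induced _ _ _) (hs k t hk).
have [G1|G1] := leqP #|nodes G| 1.
  left; have /cards1P[p Gp] : #|nodes G| == 1%N by rewrite eqn_leq G1 card_gt0.
  exists p; split=> //; first exact: full_sum_set1.
  exact: SEA_term_expressible ex.
have np p : ~~ pendant G p.
  by apply: contra stop => pp; rewrite /can_continue G1; apply/existsP; exists p.
have [G4 G3] := no_pendant_card wf cc G1 np.
right; split=> //; split; first exact: layer_FS_term_expressible hA ex wf G0.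
rewrite G4 /=; apply: (sum_card_ge2 pS Gsub) => B BG.
(* Pruning never increases the number of neighbors, so the surviving blocks
   already had three neighbors at the start. *)
have B3 := leq_trans (G3 B BG) (nbG B).
have BS := subsetP Gsub B BG.
have B0 : (0 < #|B|)%N by rewrite card_gt0 (partition_neq0 pS).
rewrite ltn_neqAle B0 andbT eq_sym; apply/negP => /cards1P[r Br].
rewrite Br in B3 BS; move: B3.
by rewrite leqNgt ltnS card_neighbors_singleton.
Qed.
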